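(* Let $R$ be a commutative artin ring, $\mathcal{C}$ a dualizing $R$-variety, $P=\mathrm{Hom}_{\mathcal{C}}(C,-)\in\mathrm{mod}(\mathcal{C})$ and $J=I_0(P/\mathrm{rad}(P))$. Consider the functor $\mathrm{Hom}_{\mathrm{mod}(\mathcal{C})}(P,-):\mathrm{mod}(\mathcal{C})\to\mathrm{mod}(R_{P})$. The following hold. (a) The restrictions $\mathrm{Hom}_{\mathrm{mod}(\mathcal{C})}(P,-)|_{\mathbb{P}_{1}}:\mathbb{P}_{1}\to\mathrm{mod}(R_{P})$ and $\mathrm{Hom}_{\mathrm{mod}(\mathcal{C})}(P,-)|_{\mathbb{I}_{1}}:\mathbb{I}_{1}\to\mathrm{mod}(R_{P})$ are equivalences. (b) For $X,Y\in\mathrm{mod}(\mathcal{C})$ let $$\rho_{X,Y}:\mathrm{Hom}_{\mathrm{mod}(\mathcal{C})}(X,Y)\to\mathrm{Hom}_{R_{P}}\big(\mathrm{Hom}_{\mathrm{mod}(\mathcal{C})}(P,X),\mathrm{Hom}_{\mathrm{mod}(\mathcal{C})}(P,Y)\big),\quad f\mapsto\mathrm{Hom}_{\mathrm{mod}(\mathcal{C})}(P,f).$$ Then: (i) $\rho_{X,Y}$ is a monomorphism if either $X\in\mathbb{P}_{0}$ or $Y\in\mathbb{I}_{0}$; (ii) $\rho_{X,Y}$ is an isomorphism if $X\in\mathbb{P}_{0}$ and $Y\in\mathbb{I}_{0}$; (iii) $\rho_{X,Y}$ is an isomorphism if either $X\in\mathbb{P}_{1}$ or $Y\in\mathbb{I}_{1}$.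 (c) The functor $\mathrm{Hom}_{\mathrm{mod}(\mathcal{C})}(P,-)$ induces an equivalence between $\mathrm{add}(P)$ and the category of finitely generated projective $R_{P}$-modules, and between $\mathrm{add}(J)$ and the category of finitely generated injective $R_{P}$-modules.
   Context: A Hom-finite $R$-variety is a small additive category in which idempotents split, whose Hom-sets are finitely generated $R$-modules with $R$-bilinear composition. $\mathrm{Mod}(\mathcal{C})$ is the category of additive functors $\mathcal{C}\to\mathbf{Ab}$ and $\mathrm{mod}(\mathcal{C})$ its full subcategory of finitely presented functors. With $E$ the injective envelope of $R/\mathrm{rad}(R)$, put $\mathbb{D}_{\mathcal{C}}(M)(X)=\mathrm{Hom}_R(M(X),E)$ for functors with finitely generated values; $\mathcal{C}$ is dualizing if $\mathbb{D}_{\mathcal{C}}$ induces a duality between $\mathrm{mod}(\mathcal{C})$ and $\mathrm{mod}(\mathcal{C}^{op})$. $R_P=\mathrm{End}_{\mathrm{mod}(\mathcal{C})}(P)^{op}$ and $\mathrm{mod}(R_P)$ is the category of finitely generated left $R_P$-modules. $\mathrm{rad}(P)$ is the intersection of the maximal submodules of $P$, and $J=I_0(P/\mathrm{rad}(P))$ is the injective envelope of $P/\mathrm{rad}(P)$ in $\mathrm{mod}(\mathcal{C})$. $\mathrm{add}(M)$ is the class of direct summands of finite direct sums of copies of $M$. For $0\leq k\leq\infty$, $\mathbb{P}_k$ (resp. $\mathbb{I}_k$) is the full subcategory of $\mathrm{mod}(\mathcal{C})$ of those $X$ having a projective resolution $\cdots\to P_1\to P_0\to X\to0$ with $P_i\in\mathrm{add}(P)$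 for $0\leq i\leq k$ (resp. an injective coresolution $0\to X\to J_0\to J_1\to\cdots$ with $J_i\in\mathrm{add}(J)$ for $0\leq i\leq k$). *)

(* Defs.v *)
From HB Require Import structures.
From mathcomp Require Import all_boot all_algebra generic_quotient ring_quotient.
From mathcomp Require Import boolp.

Set Implicit Arguments.
Unset Strict Implicit.
Unset Printing Implicit Defensive.

Import GRing.Theory.
Local Open Scope ring_scope.
Local Open Scope quotient_scope.

Record category := Category {
  obj :> Type;
  mor : obj -> obj -> Type;
  idc : forall X, mor X X;
  compc : forall X Y Z, mor Y Z -> mor X Y -> mor X Z;
  compcA : forall X Y Z W (h : mor Z W) (g : mor Y Z) (f : mor X Y),
    compc h (compc g f) = compc (compc h g) f;
  comp1c : forall X Y (f : mor X Y), compc (idc Y) f = f;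
  compc1 : forall X Y (f : mor X Y), compc f (idc X) = f
}.
Arguments mor {_}.
Arguments idc {_}.
Arguments compc {_ _ _ _}.
Notation "g ∘ f" := (compc g f) (at level 40, left associativity).

Record functor (T S : category) := Functor {
  fobj :> T -> S;
  fmor : forall X Y, mor X Y -> mor (fobj X) (fobj Y);
  fmor1 : forall X, fmor (idc X) = idc (fobj X);
  fmorM : forall X Y Z (g : mor Y Z) (f : mor X Y), fmor (g ∘ f) = fmor g ∘ fmor f
}.

Section Functors.
Variables T S U : category.

Definition fid : functor T T :=
  @Functor T T id (fun _ _ f => f) (fun _ => erefl) (fun _ _ _ _ _ => erefl).

Lemma fcomp1 (G : functor S U) (F : functor T S) X :
  fmor G (fmor F (idc X)) = idc (G (F X)).
Proof. by rewrite !fmor1. Qed.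

Lemma fcompM (G : functor S U) (F : functor T S) X Y Z (g : mor Y Z) (f : mor X Y) :
  fmor G (fmor F (g ∘ f)) = fmor G (fmor F g) ∘ fmor G (fmor F f).
Proof. by rewrite !fmorM. Qed.

Definition fcomp (G : functor S U) (F : functor T S) : functor T U :=
  @Functor T U (fun X => G (F X)) (fun X Y f => fmor G (fmor F f))
    (fcomp1 G F) (fcompM G F).

Definition is_iso (X Y : T) (f : mor X Y) :=
  exists g : mor Y X, g ∘ f = idc X /\ f ∘ g = idc Y.

Definition isomorphic (X Y : T) := exists f : mor X Y, is_iso f.

Definition is_mono (X Y : T) (f : mor X Y) :=
  forall Z (g h : mor Z X), f ∘ g = f ∘ h -> g = h.

Definition is_epi (X Y : T) (f : mor X Y) :=
  forall Z (g h : mor Y Z), g ∘ f = h ∘ f -> g = h.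
End Functors.

Definition nat_isomorphic (T S : category) (F G : functor T S) :=
  exists eta : forall X, mor (F X) (G X),
    (forall X, is_iso (eta X)) /\
    (forall X Y (f : mor X Y), eta Y ∘ fmor F f = fmor G f ∘ eta X).

Definition is_equivalence (T S : category) (F : functor T S) :=
  exists G : functor S T,
    nat_isomorphic (fcomp G F) (fid T) /\ nat_isomorphic (fcomp F G) (fid S).

Definition opcat (T : category) : category :=
  @Category T (fun X Y => mor Y X) (fun X => idc X) (fun _ _ _ g f => f ∘ g)
    (fun _ _ _ _ _ _ _ => esym (compcA _ _ _))
    (fun _ _ f => compc1 f) (fun _ _ f => comp1c f).

Definition full (T : category) (Q : T -> Prop) : category :=
  @Category {X : T | Q X} (fun X Y => mor (sval X) (sval Y))
    (fun X => idc (sval X)) (fun _ _ _ g f => g ∘ f)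
    (fun _ _ _ _ _ _ _ => compcA _ _ _)
    (fun _ _ f => comp1c f) (fun _ _ f => compc1 f).

Definition frestr (T S : category) (F : functor T S) (Q : T -> Prop) (Q' : S -> Prop)
    (FQ : forall X, Q X -> Q' (F X)) : functor (full Q) (full Q') :=
  @Functor (full Q) (full Q') (fun X => exist Q' (F (sval X)) (FQ _ (svalP X)))
    (fun X Y f => @fmor T S F (sval X) (sval Y) f)
    (fun X => fmor1 F (sval X)) (fun _ _ _ g f => fmorM F g f).

Definition induces_equivalence (T S : category) (F : functor T S)
    (Q : T -> Prop) (Q' : S -> Prop) :=
  exists FQ : forall X, Q X -> Q' (F X), is_equivalence (frestr FQ).

(* Projectivity, injectivity and injective envelopes in the full subcategory [Q].
   Monomorphisms and epimorphisms are tested in [T]; for [Q] = finitely presented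
   functors on a dualizing variety this agrees with testing them inside [Q].
   [injective_envelope_in] does not ask for [Q X]. *)
Definition projective_in (T : category) (Q : T -> Prop) (X : T) :=
  Q X /\ forall A B : T, Q A -> Q B -> forall (e : mor A B) (f : mor X B),
    is_epi e -> exists g : mor X A, e ∘ g = f.

Definition injective_in (T : category) (Q : T -> Prop) (X : T) :=
  Q X /\ forall A B : T, Q A -> Q B -> forall (m : mor A B) (f : mor A X),
    is_mono m -> exists g : mor B X, g ∘ m = f.

Definition injective_envelope_in (T : category) (Q : T -> Prop) (X J : T)
    (i : mor X J) :=
  [/\ is_mono i, injective_in Q J &
      forall (Y : T) (g : mor J Y), Q Y -> is_mono (g ∘ i) -> is_mono g].

Definition everything (T : category) (X : T) := True.

Lemma linear_ext (A : pzRingType) (U V : lmodType A) (f g : {linear U -> V}) :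
  f =1 g -> f = g.
Proof.
case: f g => [f cf] [g cg] /= /funext fg; move: cf cg; rewrite {}fg => cf cg.
congr GRing.Linear.Pack.
case: cf cg => [[a] [b]] [[a'] [b']].
by rewrite (Prop_irrelevance a a') (Prop_irrelevance b b').
Qed.

Section ModuleCategory.
Variable A : pzRingType.

Definition lid (U : lmodType A) : {linear U -> U} := idfun.
Definition lcomp (U V W : lmodType A) (g : {linear V -> W}) (f : {linear U -> V}) :
  {linear U -> W} := g \o f.

Lemma lcompA (U V W X : lmodType A) (h : {linear W -> X}) (g : {linear V -> W})
  (f : {linear U -> V}) : lcomp h (lcomp g f) = lcomp (lcomp h g) f.
Proof. exact: linear_ext. Qed.
Lemma lcomp1l (U V : lmodType A) (f : {linear U -> V}) : lcomp (lid V) f = f.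
Proof. exact: linear_ext. Qed.
Lemma lcompl1 (U V : lmodType A) (f : {linear U -> V}) : lcomp f (lid U) = f.
Proof. exact: linear_ext. Qed.

Definition ModR : category :=
  @Category (lmodType A) (fun U V => {linear U -> V}) lid lcomp lcompA lcomp1l lcompl1.

Definition fg (M : ModR) :=
  exists (n : nat) (v : 'I_n -> M),
    forall m : M, exists c : 'I_n -> A, m = \sum_i c i *: v i.

Definition maximal_submod (M : lmodType A) (N : submodClosed M) :=
  (exists x, x \notin N) /\
  forall L : submodClosed M, {subset N <= L} -> (exists x, x \notin L) -> {subset L <= N}.

Definition radm (M : lmodType A) : {pred M} :=
  fun x => `[< forall N : submodClosed M, maximal_submod N -> x \in N >].
Arguments radm : clear implicits.

Lemma radm_submod (M : lmodType A) : submod_closed (radm M).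
Proof.
split=> [|a x y /asboolP xr /asboolP yr]; apply/asboolP => N maxN; first exact: rpred0.
by apply: rpredD; [apply: rpredZ; apply: xr | apply: yr].
Qed.
HB.instance Definition _ (M : lmodType A) :=
  GRing.isSubmodClosed.Build A M (radm M) (radm_submod M).

(* The library quotients a [zmodType] by a [zmodClosed] predicate; [modsub] and
   [modquot] recover the module structure when that predicate is a submodule. *)
Definition modsub (M : lmodType A) (N : submodClosed M) : {pred M} := N.

Lemma modsub_zmod (M : lmodType A) (N : submodClosed M) : zmod_closed (modsub N).
Proof.
split=> [|x y xN yN]; first exact: (rpred0 N).
by rewrite -scaleN1r; apply: (rpredD (S := N)) => //; apply: (rpredZ (s := N)).
Qed.
HB.instance Definition _ (M : lmodType A) (N : submodClosed M) :=
  GRing.isZmodClosed.Build M (modsub N) (modsub_zmod N).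

Definition modquot (M : lmodType A) (N : submodClosed M) : Type :=
  {ideal_quot (modsub N)}.
HB.instance Definition _ (M : lmodType A) (N : submodClosed M) :=
  GRing.Zmodule.on (modquot N).

Section ModQuot.
Variables (M : lmodType A) (N : submodClosed M).
Local Notation Q := {ideal_quot (modsub N)}.

Definition modquot_scale (a : A) (x : Q) : Q := \pi_Q (a *: repr x).

Lemma modquot_scaleE a x : modquot_scale a (\pi_Q x) = \pi_Q (a *: x).
Proof.
apply/eqP; rewrite -Quotient.idealrBE -scalerBr; apply: (rpredZ (s := N)).
by rewrite -[_ \in N]/(_ \in modsub N) Quotient.idealrBE reprK.
Qed.

Lemma modquot_scaleA a b v :
  modquot_scale a (modquot_scale b v) = modquot_scale (a * b) v.
Proof.
elim/quotW: v => v.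
by rewrite (modquot_scaleE b) (modquot_scaleE a) (modquot_scaleE (a * b)) scalerA.
Qed.
Lemma modquot_scale1 : left_id 1 modquot_scale.
Proof. by elim/quotW=> v; rewrite modquot_scaleE scale1r. Qed.
Lemma modquot_scaleDr : right_distributive modquot_scale +%R.
Proof.
move=> a; elim/quotW=> u; elim/quotW=> v.
by rewrite -(raddfD \pi_Q) !modquot_scaleE -(raddfD \pi_Q) scalerDr.
Qed.
Lemma modquot_scaleDl v : {morph modquot_scale^~ v : a b / a + b}.
Proof.
elim/quotW: v => v a b.
by rewrite (modquot_scaleE a) (modquot_scaleE b) (modquot_scaleE (a + b)) scalerDl raddfD.
Qed.
HB.instance Definition _ := GRing.Zmodule_isLmodule.Build A (modquot N)
  modquot_scaleA modquot_scale1 modquot_scaleDr modquot_scaleDl.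
End ModQuot.
End ModuleCategory.
Arguments fg {A} M.
Arguments radm {A} M.

Section LinHom.
Variables (A : pzRingType) (U V : lmodType A).
(* The library puts no group structure on [{linear U -> V}]. *)
Definition linhom : Type := {linear U -> V}.
HB.instance Definition _ := gen_eqMixin linhom.
HB.instance Definition _ := gen_choiceMixin linhom.
Implicit Types f g h : {linear U -> V}.
Definition linhom0 : linhom := (\0 : {linear U -> V}).
Definition linhomN (f : linhom) : linhom := (\- (f : {linear U -> V}) : {linear U -> V}).
Definition linhomD (f g : linhom) : linhom :=
  ((f : {linear U -> V}) \+ (g : {linear U -> V}) : {linear U -> V}).
Lemma linhomDA : associative linhomD.
Proof. by move=> f g h; apply: linear_ext => x /=; rewrite addrA. Qed.
Lemma linhomDC : commutative linhomD.
Proof. by move=> f g; apply: linear_ext => x /=; rewrite addrC. Qed.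
Lemma linhom0D : left_id linhom0 linhomD.
Proof. by move=> f; apply: linear_ext => x /=; rewrite add0r. Qed.
Lemma linhomND : left_inverse linhom0 linhomN linhomD.
Proof. by move=> f; apply: linear_ext => x /=; rewrite addNr. Qed.
HB.instance Definition _ := GRing.isZmodule.Build linhom linhomDA linhomDC linhom0D linhomND.
End LinHom.

Definition artinian (R : comPzRingType) :=
  forall I : nat -> submodClosed (R^o : lmodType R),
    (forall n, {subset I n.+1 <= I n}) ->
    exists N, forall n, (N <= n)%N -> {subset I N <= I n}.

Record rcategory (R : comPzRingType) := RCategory {
  robj :> Type;
  rhom : robj -> robj -> lmodType R;
  rid : forall X, rhom X X;
  rcomp : forall X Y Z, rhom Y Z -> rhom X Y -> rhom X Z;
  rcompA : forall X Y Z W (h : rhom Z W) (g : rhom Y Z) (f : rhom X Y),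
    rcomp h (rcomp g f) = rcomp (rcomp h g) f;
  rcomp1l : forall X Y (f : rhom X Y), rcomp (rid Y) f = f;
  rcompr1 : forall X Y (f : rhom X Y), rcomp f (rid X) = f;
  rcomp_linl : forall X Y Z (f : rhom X Y), linear (fun g : rhom Y Z => rcomp g f);
  rcomp_linr : forall X Y Z (g : rhom Y Z), linear (fun f : rhom X Y => rcomp g f)
}.
Arguments rhom {R _}.
Arguments rid {R _}.
Arguments rcomp {R _ _ _ _}.
Notation "g ⊚ f" := (rcomp g f) (at level 40, left associativity).

Definition rop (R : comPzRingType) (C : rcategory R) : rcategory R :=
  @RCategory R C (fun X Y => rhom Y X) (fun X => rid X) (fun _ _ _ g f => f ⊚ g)
    (fun _ _ _ _ _ _ _ => esym (rcompA _ _ _))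
    (fun _ _ f => rcompr1 f) (fun _ _ f => rcomp1l f)
    (fun _ _ _ f => @rcomp_linr R C _ _ _ f) (fun _ _ _ g => @rcomp_linl R C _ _ _ g).

Lemma rcompZl (R : comPzRingType) (C : rcategory R) (X Y Z : C) a (g : rhom Y Z)
  (f : rhom X Y) : (a *: g) ⊚ f = a *: (g ⊚ f).
Proof. exact: (GRing.scalable_linear (rcomp_linl f)). Qed.
Lemma rcompZr (R : comPzRingType) (C : rcategory R) (X Y Z : C) a (g : rhom Y Z)
  (f : rhom X Y) : g ⊚ (a *: f) = a *: (g ⊚ f).
Proof. exact: (GRing.scalable_linear (rcomp_linr g)). Qed.

Section Varieties.
Variables (R : comPzRingType) (C : rcategory R).

Definition has_zero_object := exists Z : C, rid Z = 0.

Definition has_biproducts := forall X Y : C,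
  exists (Z : C) (i : rhom X Z) (j : rhom Y Z) (p : rhom Z X) (q : rhom Z Y),
    [/\ p ⊚ i = rid X, q ⊚ j = rid Y, p ⊚ j = 0, q ⊚ i = 0
      & i ⊚ p + j ⊚ q = rid Z].

Definition idempotents_split := forall (X : C) (e : rhom X X), e ⊚ e = e ->
  exists (Y : C) (p : rhom X Y) (i : rhom Y X), i ⊚ p = e /\ p ⊚ i = rid Y.

Definition hom_finite_variety :=
  [/\ has_zero_object, has_biproducts, idempotents_split
    & forall X Y : C, fg (rhom X Y)].

Record afunctor := AFunctor {
  aobj :> C -> zmodType;
  amap : forall X Y, rhom X Y -> aobj X -> aobj Y;
  amap_elD : forall X Y (f : rhom X Y), {morph amap f : x y / x + y};
  amapD : forall X Y (f g : rhom X Y) x, amap (f + g) x = amap f x + amap g x;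
  amap1 : forall X (x : aobj X), amap (rid X) x = x;
  amapM : forall X Y Z (g : rhom Y Z) (f : rhom X Y) x,
    amap (g ⊚ f) x = amap g (amap f x)
}.

Arguments amap _ {X Y}.

Lemma amap_el0 (M : afunctor) X Y (f : rhom X Y) : amap M f 0 = 0.
Proof. by apply: (addIr (amap M f 0)); rewrite -amap_elD !add0r. Qed.
Lemma amap_elN (M : afunctor) X Y (f : rhom X Y) x : amap M f (- x) = - amap M f x.
Proof. by apply/eqP; rewrite -addr_eq0 -amap_elD addNr amap_el0. Qed.
Lemma amap_elB (M : afunctor) X Y (f : rhom X Y) x y :
  amap M f (x - y) = amap M f x - amap M f y.
Proof. by rewrite amap_elD amap_elN. Qed.

Record nattrans (M N : afunctor) := NatTrans {
  napp :> forall X, M X -> N X;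
  nappD : forall X, {morph @napp X : x y / x + y};
  nappE : forall X Y (f : rhom X Y) x, napp (amap M f x) = amap N f (napp x)
}.

Lemma nattrans_ext (M N : afunctor) (s t : nattrans M N) :
  (forall X x, s X x = t X x) -> s = t.
Proof.
case: s t => [s sD sE] [t tD tE] /= st.
have {}st : s = t by apply: functional_extensionality_dep => X; apply/funext => x; apply: st.
by move: sD sE tD tE; rewrite st => *; congr NatTrans; apply: Prop_irrelevance.
Qed.

Lemma napp0 (M N : afunctor) (s : nattrans M N) X : s X 0 = 0.
Proof. by apply: (addIr (s X 0)); rewrite -nappD !add0r. Qed.

HB.instance Definition _ (M N : afunctor) := gen_eqMixin (nattrans M N).
HB.instance Definition _ (M N : afunctor) := gen_choiceMixin (nattrans M N).

Section NatZmod.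
Variables M N : afunctor.
Implicit Types s t u : nattrans M N.

Definition nt0 : nattrans M N.
Proof.
exists (fun X x => 0); first by move=> X x y; rewrite addr0.
by move=> X Y f x; rewrite amap_el0.
Defined.
Definition ntN s : nattrans M N.
Proof.
exists (fun X x => - s X x); first by move=> X x y; rewrite nappD opprD.
by move=> X Y f x; rewrite nappE amap_elN.
Defined.
Definition ntD s t : nattrans M N.
Proof.
exists (fun X x => s X x + t X x); first by move=> X x y; rewrite !nappD addrACA.
by move=> X Y f x; rewrite !nappE amap_elD.
Defined.
Lemma ntDA : associative ntD.
Proof. by move=> s t u; apply: nattrans_ext => X x /=; rewrite addrA. Qed.
Lemma ntDC : commutative ntD.
Proof. by move=> s t; apply: nattrans_ext => X x /=; rewrite addrC. Qed.
Lemma nt0D : left_id nt0 ntD.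
Proof. by move=> s; apply: nattrans_ext => X x /=; rewrite add0r. Qed.
Lemma ntND : left_inverse nt0 ntN ntD.
Proof. by move=> s; apply: nattrans_ext => X x /=; rewrite addNr. Qed.
HB.instance Definition _ := GRing.isZmodule.Build (nattrans M N) ntDA ntDC nt0D ntND.
End NatZmod.

Definition ntid (M : afunctor) : nattrans M M.
Proof. by exists (fun X x => x). Defined.

Definition ntcomp (L M N : afunctor) (t : nattrans M N) (s : nattrans L M) :
  nattrans L N.
Proof.
exists (fun X x => t X (s X x)); first by move=> X x y; rewrite !nappD.
by move=> X Y f x; rewrite !nappE.
Defined.

Lemma ntcompA (K L M N : afunctor) (u : nattrans M N) (t : nattrans L M)
  (s : nattrans K L) : ntcomp u (ntcomp t s) = ntcomp (ntcomp u t) s.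
Proof. exact: nattrans_ext. Qed.
Lemma ntcomp1l (M N : afunctor) (s : nattrans M N) : ntcomp (ntid N) s = s.
Proof. exact: nattrans_ext. Qed.
Lemma ntcompl1 (M N : afunctor) (s : nattrans M N) : ntcomp s (ntid M) = s.
Proof. exact: nattrans_ext. Qed.

Definition ModC : category :=
  @Category afunctor nattrans ntid ntcomp ntcompA ntcomp1l ntcompl1.

(* Exactness, injectivity and surjectivity of morphisms of functors are valuewise. *)
Definition exact_at (L M N : afunctor) (s : nattrans L M) (t : nattrans M N) :=
  forall X (y : M X), t X y = 0 <-> exists x, s X x = y.

Definition ninjective (M N : afunctor) (s : nattrans M N) :=
  forall X, injective (s X).

Definition nsurjective (M N : afunctor) (s : nattrans M N) :=
  forall X (y : N X), exists x, s X x = y.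

Definition repr_functor (X : C) : afunctor.
Proof.
apply: (@AFunctor (fun Y => rhom X Y) (fun Y Z g f => g ⊚ f)).
- by move=> Y Z g f h; have := rcomp_linr g 1 f h; rewrite !scale1r.
- by move=> Y Z g h f; have := rcomp_linl f 1 g h; rewrite !scale1r.
- by move=> Y f; apply: rcomp1l.
- by move=> Y Z W g f h; rewrite rcompA.
Defined.

(* As C is additive, single representables suffice in a finite presentation. *)
Definition fp (M : ModC) :=
  exists (C1 C0 : C) (d : nattrans (repr_functor C1) (repr_functor C0))
    (e : nattrans (repr_functor C0) M), exact_at d e /\ nsurjective e.

Definition sum_functor (M N : afunctor) : afunctor.
Proof.
apply: (@AFunctor (fun X => (M X * N X)%type)
  (fun X Y f xy => (amap M f xy.1, amap N f xy.2))).
- by move=> X Y f [x x'] [y y'] /=; rewrite !amap_elD.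
- by move=> X Y f g [x x'] /=; rewrite !amapD.
- by move=> X [x x'] /=; rewrite !amap1.
- by move=> X Y Z g f [x x'] /=; rewrite !amapM.
Defined.

Definition pow_functor (M : afunctor) (n : nat) : afunctor.
Proof.
apply: (@AFunctor (fun X => {ffun 'I_n -> M X})
  (fun X Y f x => [ffun k => amap M f (x k)])).
- by move=> X Y f x y; apply/ffunP=> k; rewrite !ffunE amap_elD.
- by move=> X Y f g x; apply/ffunP=> k; rewrite !ffunE amapD.
- by move=> X x; apply/ffunP=> k; rewrite !ffunE amap1.
- by move=> X Y Z g f x; apply/ffunP=> k; rewrite !ffunE amapM.
Defined.

Definition in_add (M X : ModC) :=
  exists (n : nat) (Y : afunctor),
    isomorphic (sum_functor X Y : ModC) (pow_functor M n : ModC).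

Record subfunctor (M : afunctor) := SubFunctor {
  smem :> forall X, zmodClosed (M X);
  smap : forall X Y (f : rhom X Y) x, x \in smem X -> amap M f x \in smem Y
}.

Definition sub_le (M : afunctor) (S T : subfunctor M) :=
  forall X, {subset S X <= T X}.
Definition sub_proper (M : afunctor) (S : subfunctor M) :=
  exists X x, x \notin S X.
Definition maximal_sub (M : afunctor) (S : subfunctor M) :=
  sub_proper S /\
  forall T : subfunctor M, sub_le S T -> sub_proper T -> sub_le T S.

Definition radf_mem (M : afunctor) (X : C) : {pred M X} :=
  fun x => `[< forall S : subfunctor M, maximal_sub S -> x \in S X >].
Arguments radf_mem : clear implicits.

Lemma radf_mem_zmod (M : afunctor) (X : C) : zmod_closed (radf_mem M X).
Proof.
split=> [|x y /asboolP xr /asboolP yr]; apply/asboolP => S maxS; first exact: rpred0.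
by apply: rpredB; [apply: xr | apply: yr].
Qed.
HB.instance Definition _ (M : afunctor) (X : C) :=
  GRing.isZmodClosed.Build (M X) (radf_mem M X) (radf_mem_zmod M X).

Definition radf (M : afunctor) : subfunctor M.
Proof.
exists (fun X => radf_mem M X : zmodClosed (M X)) => X Y f x /asboolP xr.
by apply/asboolP => S maxS; apply: smap; apply: xr.
Defined.

Section Quotient.
Variables (M : afunctor) (S : subfunctor M).
Local Notation Q X := {ideal_quot (S X)}.

Definition quo_map X Y (f : rhom X Y) (x : Q X) : Q Y := \pi_(Q Y) (amap M f (repr x)).

Lemma quo_mapE X Y (f : rhom X Y) x : quo_map f (\pi_(Q X) x) = \pi_(Q Y) (amap M f x).
Proof.
apply/eqP; rewrite -Quotient.idealrBE -amap_elB; apply: smap.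
by rewrite Quotient.idealrBE reprK.
Qed.

Definition quo_functor : afunctor.
Proof.
apply: (@AFunctor (fun X => Q X) quo_map).
- move=> X Y f; elim/quotW=> x; elim/quotW=> y.
  by rewrite -(raddfD \pi_(Q X)) !quo_mapE -(raddfD \pi_(Q Y)) amap_elD.
- move=> X Y f g; elim/quotW=> x.
  by rewrite (quo_mapE f) (quo_mapE g) (quo_mapE (f + g)) -(raddfD \pi_(Q Y)) amapD.
- by move=> X; elim/quotW=> x; rewrite quo_mapE amap1.
- move=> X Y Z g f; elim/quotW=> x.
  by rewrite (quo_mapE f) (quo_mapE g) (quo_mapE (g ⊚ f)) amapM.
Defined.
End Quotient.

(* The full subcategories P_k and I_k of mod(C), for finite k. *)
Definition bbP (P : ModC) (k : nat) (X : ModC) :=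
  fp X /\
  exists (Q : nat -> ModC) (d : forall i, nattrans (Q i.+1) (Q i)) (e : nattrans (Q 0%N) X),
    [/\ forall i, projective_in fp (Q i),
        nsurjective e, exact_at (d 0%N) e,
        forall i, exact_at (d i.+1) (d i)
      & forall i, (i <= k)%N -> in_add P (Q i)].

Definition bbI (J : ModC) (k : nat) (X : ModC) :=
  fp X /\
  exists (Q : nat -> ModC) (d : forall i, nattrans (Q i) (Q i.+1)) (e : nattrans X (Q 0%N)),
    [/\ forall i, injective_in fp (Q i),
        ninjective e, exact_at e (d 0%N),
        forall i, exact_at (d i) (d i.+1)
      & forall i, (i <= k)%N -> in_add J (Q i)].

Definition endo (P : afunctor) : Type := nattrans P P.
HB.instance Definition _ (P : afunctor) := GRing.Zmodule.on (endo P).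

Section Endo.
Variable P : afunctor.
Definition endo_mul (s t : endo P) : endo P := ntcomp s t.
Lemma endo_mulA : associative endo_mul.
Proof. by move=> s t u; apply: nattrans_ext. Qed.
Lemma endo_mul1l : left_id (ntid P) endo_mul.
Proof. by move=> s; apply: nattrans_ext. Qed.
Lemma endo_mull1 : right_id (ntid P) endo_mul.
Proof. by move=> s; apply: nattrans_ext. Qed.
Lemma endo_mulDl : left_distributive endo_mul +%R.
Proof. by move=> s t u; apply: nattrans_ext. Qed.
Lemma endo_mulDr : right_distributive endo_mul +%R.
Proof. by move=> s t u; apply: nattrans_ext => X x /=; rewrite nappD. Qed.
HB.instance Definition _ := GRing.Zmodule_isPzRing.Build (endo P)
  endo_mulA endo_mul1l endo_mull1 endo_mulDl endo_mulDr.
End Endo.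

(* [endo P] is multiplied by composition; the left module structure of Hom(P, X)
   by precomposition is over the opposite ring. *)
Definition Rop (P : afunctor) : pzRingType := (endo P)^c.

Definition homP_mod (P X : afunctor) : Type := nattrans P X.
HB.instance Definition _ (P X : afunctor) := GRing.Zmodule.on (homP_mod P X).

Section HomP.
Variables P X : afunctor.
Definition homP_scale (r : Rop P) (s : homP_mod P X) : homP_mod P X := ntcomp s r.
Lemma homP_scaleA a b v : homP_scale a (homP_scale b v) = homP_scale (a * b) v.
Proof. exact: nattrans_ext. Qed.
Lemma homP_scale1 : left_id 1 homP_scale.
Proof. by move=> s; apply: nattrans_ext. Qed.
Lemma homP_scaleDr : right_distributive homP_scale +%R.
Proof. by move=> a u v; apply: nattrans_ext. Qed.
Lemma homP_scaleDl v : {morph homP_scale^~ v : a b / a + b}.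
Proof. by move=> a b; apply: nattrans_ext => Z z /=; rewrite nappD. Qed.
HB.instance Definition _ := GRing.Zmodule_isLmodule.Build (Rop P) (homP_mod P X)
  homP_scaleA homP_scale1 homP_scaleDr homP_scaleDl.
End HomP.

Definition postcomp (P X Y : afunctor) (f : nattrans X Y) (s : homP_mod P X) : homP_mod P Y :=
  ntcomp f s.
Lemma postcomp_linear (P X Y : afunctor) (f : nattrans X Y) : linear (@postcomp P X Y f).
Proof. by move=> a u v; apply: nattrans_ext => Z z /=; rewrite nappD. Qed.
HB.instance Definition _ (P X Y : afunctor) (f : nattrans X Y) :=
  GRing.isLinear.Build (Rop P) (homP_mod P X) (homP_mod P Y) *:%R (@postcomp P X Y f)
    (postcomp_linear f).

Definition HomP (P : afunctor) : functor ModC (ModR (Rop P)).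
Proof.
apply: (@Functor ModC (ModR (Rop P)) (fun X => homP_mod P X : lmodType (Rop P))
  (fun X Y f => @postcomp P X Y f : {linear homP_mod P X -> homP_mod P Y})).
- by move=> X; apply: linear_ext => s; apply: nattrans_ext.
- by move=> X Y Z g f; apply: linear_ext => s; apply: nattrans_ext.
Defined.

Definition rho (P X Y : afunctor) (f : nattrans X Y) :
  linhom (homP_mod P X) (homP_mod P Y) := fmor (HomP P) f.

Lemma rho_zmod_morphism (P X Y : afunctor) : zmod_morphism (@rho P X Y).
Proof. by move=> f g; apply: linear_ext => s; apply: nattrans_ext. Qed.
HB.instance Definition _ (P X Y : afunctor) :=
  GRing.isZmodMorphism.Build (nattrans X Y) (linhom (homP_mod P X) (homP_mod P Y))
    (@rho P X Y) (@rho_zmod_morphism P X Y).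

End Varieties.
Arguments amap {R C} _ {X Y}.

Section Dual.
Variables (R : comPzRingType) (C : rcategory R).

(* An additive functor on C takes values in R-modules: r acts on M(X) as M(r 1_X). *)
Definition rval (M : afunctor C) (X : C) : Type := M X.
HB.instance Definition _ M X := GRing.Zmodule.on (@rval M X).

Section RVal.
Variables (M : afunctor C) (X : C).
Definition rval_scale (r : R) (x : rval M X) : rval M X := amap M (r *: rid X) x.

Lemma rval_scaleA a b v : rval_scale a (rval_scale b v) = rval_scale (a * b) v.
Proof.
by rewrite /rval_scale -amapM rcompZl rcomp1l scalerA.
Qed.
Lemma rval_scale1 : left_id 1 rval_scale.
Proof. by move=> x; rewrite /rval_scale scale1r amap1. Qed.
Lemma rval_scaleDr : right_distributive rval_scale +%R.
Proof. by move=> a x y; rewrite /rval_scale amap_elD. Qed.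
Lemma rval_scaleDl v : {morph rval_scale^~ v : a b / a + b}.
Proof. by move=> a b; rewrite /rval_scale scalerDl amapD. Qed.
HB.instance Definition _ := GRing.Zmodule_isLmodule.Build R (rval M X)
  rval_scaleA rval_scale1 rval_scaleDr rval_scaleDl.
End RVal.

Lemma amap_linear (M : afunctor C) X Y (f : rhom X Y) :
  linear (amap M f : rval M X -> rval M Y).
Proof.
move=> a x y; rewrite amap_elD; congr (_ + _).
by rewrite -[RHS]amapM -[LHS]amapM rcompZl rcompZr rcomp1l rcompr1.
Qed.

Lemma napp_linear (M N : afunctor C) (s : nattrans M N) X :
  linear (s X : rval M X -> rval N X).
Proof. by move=> a x y; rewrite nappD; congr (_ + _); apply: nappE. Qed.

Definition amapL (M : afunctor C) X Y (f : rhom X Y) : rval M X -> rval M Y := amap M f.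
HB.instance Definition _ (M : afunctor C) X Y (f : rhom X Y) :=
  GRing.isLinear.Build R (rval M X) (rval M Y) *:%R (@amapL M X Y f) (@amap_linear M X Y f).

Definition nappL (M N : afunctor C) (s : nattrans M N) X : rval M X -> rval N X := s X.
HB.instance Definition _ (M N : afunctor C) (s : nattrans M N) X :=
  GRing.isLinear.Build R (rval M X) (rval N X) *:%R (@nappL M N s X) (@napp_linear M N s X).

Variable E : lmodType R.

Definition dual_functor (M : afunctor C) : afunctor (rop C).
Proof.
apply: (@AFunctor R (rop C) (fun X => linhom (rval M X) E)
  (fun (X Y : C) (f : @rhom R C Y X) phi => lcomp phi (@amapL M Y X f))).
- by move=> X Y f phi psi; apply: linear_ext.
- move=> X Y f g phi; apply: linear_ext => x /=.
  by rewrite /amapL amapD -raddfD.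
- by move=> X phi; apply: linear_ext => x /=; rewrite /amapL amap1.
- by move=> X Y Z g f phi; apply: linear_ext => x /=; rewrite /amapL amapM.
Defined.

Definition dual_nattrans (M N : afunctor C) (s : nattrans M N) :
  nattrans (dual_functor N) (dual_functor M).
Proof.
exists (fun X phi => lcomp phi (@nappL M N s X)).
- by move=> X phi psi; apply: linear_ext.
- by move=> X Y f phi; apply: linear_ext => x /=; rewrite /amapL /nappL nappE.
Defined.

Definition Dual : functor (opcat (ModC C)) (ModC (rop C)).
Proof.
apply: (@Functor (opcat (ModC C)) (ModC (rop C)) dual_functor
  (fun M N s => dual_nattrans s)).
- by move=> M; apply: nattrans_ext => X phi; apply: linear_ext.
- by move=> L M N t s; apply: nattrans_ext => X phi; apply: linear_ext.
Defined.

(* [Dual] is defined on all additive functors; finitely presented ones have finitely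
   generated values when C is Hom-finite. *)
Definition dualizing :=
  hom_finite_variety C /\ induces_equivalence Dual (@fp R C) (@fp R (rop C)).
End Dual.

(* Main.v *)
Require Import Defs.
From HB Require Import structures.
From mathcomp Require Import all_boot all_algebra generic_quotient ring_quotient.
From mathcomp Require Import boolp classical_sets.
Set Implicit Arguments.
Unset Strict Implicit.
Unset Printing Implicit Defensive.
Import GRing.Theory.
Local Open Scope ring_scope.
Local Open Scope quotient_scope.

(** Write [A] for [Rop P].  By the Yoneda lemma [HomP P X] is the value of [X] at [C0],
    with [A] acting through the endomorphisms of [C0], so the theorem compares a
    functor with its value at one object.  Two objects make the comparison exact: [P]
    itself, and the injective functor [corepr E C0], written [I] below, whose value at
    [Y] is the [E]-dual of the morphisms from [Y] to [C0].  A transformation [X -> I] is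
    an [R]-linear map from the value of [X] at [C0] to [E] ([coyon]), and an [A]-linear
    map [M -> HomP P I] is an [R]-linear map from [M] to [E] ([coind]); hence
    [rho P X I] is bijective for every [X], as [rho P P Y] is for every [Y].  These two
    facts pass to summands of powers.  For [X] in P_0 a linear map on [HomP P X] lifts to
    a transformation on a cover of [X] by a summand of a power of [P]; it descends to [X]
    if it kills the kernel of the cover, and it does so if that kernel is generated at
    [C0] (X in P_1) or if nothing nonzero in the target is invisible at [C0] (Y in I_0).
    The case of I_1 is dual ([rho_surj_descend], [rho_surj_mixed], [rho_surj_P1],
    [rho_surj_I1]).

    It remains to see that [J] and [I] have the same summands of powers; they need not
    be isomorphic by construction, so each is embedded in a power of the other.  The top
    [P / rad P] has no nonzero subfunctor that vanishes at [C0], so finitely many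
    functionals embed it in a power of [I], and the embedding extends to [J], where it
    stays injective because [J] is an envelope ([envelope_retract_corepr]).  Conversely
    every nonzero element of a finitely presented functor at [C0] survives in [J]
    ([envelope_separates]), so finitely many maps embed [I] in a power of [J]
    ([corepr_retract_envelope]).  In both cases finitely many maps suffice because
    finitely generated modules over the artinian ring [R] satisfy the descending chain
    condition ([fg_dcc], [dcc_separation]).  The second case needs semisimplicity of
    [A / rad A] in the form of [top_separation], which for the ring [R] also shows that
    [E] is a cogenerator ([cogenerator]).

    The duality enters through two facts: finitely presented functors are reflexive
    ([bidual_inj], [bidual_surj]), which is a formal consequence of the duality being
    fully faithful, and therefore kernels of transformations between them are again
    finitely presented ([kernel_cover], [ker_fp]), being duals of cokernels.

    For density, a finitely generated [A]-module [M] embeds in the value of a power of [I]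
    ([fg_embedding]) and is a quotient of the value of a power of [P] ([free_cover]).
    The composite is induced by a transformation, whose kernel is covered by a
    representable functor; so the relations of [M] are finitely generated, and the
    cokernel they define in the category of functors realizes [M] ([P1_dense]).  In the
    same way [M] is the kernel of a map between values of powers of [I] ([I1_dense]).
    Finitely generated projective and injective modules are images of idempotents, and
    idempotents lift ([retract_realization]). *)

(** * Submodules, chain conditions and the radical of a ring *)

Section Submodules.
Variables (A : pzRingType) (V : lmodType A).

(** Submodules are propositional predicates here, so that images, sums and
    intersections can be formed without repacking; [submod_of] packs them. *)
Definition submodule (U : V -> Prop) :=
  U 0 /\ forall a x y, U x -> U y -> U (a *: x + y).

Section Closure.
Variables (U : V -> Prop) (hU : submodule U).
Lemma submodule0 : U 0. Proof. by case: hU. Qed.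
Lemma submoduleD x y : U x -> U y -> U (x + y).
Proof. by move=> hx hy; rewrite -[x]scale1r; apply: (proj2 hU). Qed.
Lemma submoduleZ a x : U x -> U (a *: x).
Proof. by move=> hx; rewrite -[_ *: _]addr0; apply: (proj2 hU) => //; case: hU. Qed.
Lemma submoduleN x : U x -> U (- x).
Proof. by move=> hx; rewrite -scaleN1r; apply: submoduleZ. Qed.
Lemma submoduleB x y : U x -> U y -> U (x - y).
Proof. by move=> hx hy; apply: submoduleD => //; apply: submoduleN. Qed.
End Closure.

Definition subpred (U : V -> Prop) (_ : submodule U) : {pred V} := fun x => `[< U x >].
Section Subpred.
Variables (U : V -> Prop) (hU : submodule U).
Lemma subpred_closed : submod_closed (subpred hU).
Proof.
split=> [|a x y /asboolP hx /asboolP hy]; apply/asboolP; first exact: submodule0 hU.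
exact: (proj2 hU).
Qed.
HB.instance Definition _ := GRing.isSubmodClosed.Build A V (subpred hU) subpred_closed.
Definition submod_of : submodClosed V := subpred hU.
Lemma in_submod_of x : (x \in submod_of) <-> U x.
Proof. by split=> [/asboolP|h]; last apply/asboolP. Qed.
End Subpred.

Lemma submodule_mem (N : submodClosed V) : submodule (fun x => x \in N).
Proof.
split=> [|a x y hx hy]; first exact: rpred0.
by apply: rpredD => //; apply: (rpredZ (s := N)).
Qed.

(** The chains are confined to [W] so that the condition can be propagated through the
    submodules spanned by the first generators of a module. *)
Definition dcc_in (W : V -> Prop) :=
  forall U : nat -> V -> Prop, (forall n, submodule (U n)) ->
    (forall n x, U n x -> W x) -> (forall n x, U n.+1 x -> U n x) ->
  exists N, forall n, (N <= n)%N -> forall x, U N x -> U n x.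

Lemma chain_le (U : nat -> V -> Prop) m n :
  (forall n x, U n.+1 x -> U n x) -> (m <= n)%N -> forall x, U n x -> U m x.
Proof.
move=> dec /subnK <-; elim: (n - m)%N => [|k IH] x //= hx; apply: IH.
exact: dec.
Qed.

Definition dcc := dcc_in (fun=> True).

(** A family of submodules without a minimal member would contain a strictly
    decreasing sequence, chosen one term after the other. *)
Lemma dcc_min (F : (V -> Prop) -> Prop) : dcc ->
    (forall U, F U -> submodule U) -> (exists U, F U) ->
  exists2 U, F U & forall U', F U' -> (forall x, U' x -> U x) -> forall x, U x -> U' x.
Proof.
move=> hV hF [U0 hU0]; apply: contrapT => nomin.
have next (U : {U | F U}) :
    exists U' : {U | F U}, (forall x, sval U' x -> sval U x) /\ ~ (forall x, sval U x -> sval U' x).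
  apply: contrapT => no; apply: nomin; exists (sval U); first exact: svalP.
  move=> U' hU' sub; apply: contrapT => nsub; apply: no.
  by exists (exist _ U' hU').
have [f hf] := choice next.
pose s n := iter n f (exist _ U0 hU0).
have [n|//|n x /=|N hN] := hV (fun n => sval (s n)).
- exact: (hF _ (svalP (s n))).
- exact: (proj1 (hf (s n))).
- by have [_] := hf (s N); apply; apply: (hN N.+1).
Qed.

(** A minimal finite intersection of the [k t] lies in every [k t]: intersecting it with
    one more cannot make it smaller. *)
Lemma dcc_separation (T : Type) (k : T -> V -> Prop) : dcc ->
    (forall t, submodule (k t)) -> (forall x, (forall t, k t x) -> x = 0) ->
  exists n (t : 'I_n -> T), forall x, (forall i, k (t i) x) -> x = 0.
Proof.
move=> hV hk sep.
pose F U := exists n (t : 'I_n -> T), U = fun x => forall i, k (t i) x.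
have [_ [n [t ->]]||U [n [t ->]] minU] := dcc_min (F := F) hV.
- split=> [i|a x y hx hy i]; first exact: submodule0 (hk _).
  by apply: (proj2 (hk _)).
- have t0 : 'I_0 -> T by case.
  by exists (fun x => forall i, k (t0 i) x); exists 0%N, t0.
exists n, t => x hx; apply: sep => s.
pose t' (i : 'I_n.+1) := if unlift ord0 i is Some j then t j else s.
have Ft' : F (fun x => forall i, k (t' i) x) by exists n.+1, t'.
have /(_ _ x hx ord0) := minU _ Ft'.
rewrite /t' unlift_none; apply=> y hy i.
by have := hy (lift ord0 i); rewrite liftK.
Qed.

End Submodules.

(** The two rings may differ: [f] compares a module over one ring with its restriction
    of scalars to the other, which has more submodules. *)
Lemma dcc_bij (A B : pzRingType) (V : lmodType A) (W : lmodType B) (f : W -> V) :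
  (forall U : W -> Prop, submodule U -> submodule (fun x => exists2 y, U y & f y = x)) ->
  injective f -> dcc V -> dcc W.
Proof.
move=> hf inj hV U hU _ dec.
have [n|//|n x [y hy <-]|N hN] := hV (fun n x => exists2 y, U n y & f y = x).
- exact: hf.
- by exists y => //; apply: dec.
exists N => n le x hx; have [|y hy /inj <- //] := hN n le (f x).
by exists x.
Qed.

Section FinitelyGenerated.
Variable R : comPzRingType.
Hypothesis hR : artinian R.

Lemma artinian_dcc : dcc (R^o : lmodType R).
Proof.
move=> U hU _ dec.
have [n x /in_submod_of/dec h|N hN] := hR (I := fun n => submod_of (hU n)).
  exact/in_submod_of.
exists N => n le x hx; apply/(in_submod_of (hU n)); apply: (hN n le).
exact/in_submod_of.
Qed.

(** Extensions of artinian modules are artinian: a member [U n] of the chain is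
    controlled by its trace on [W] and by the ideal of the coefficients of [v]
    that occur in it. *)
Lemma dcc_in_extend (V : lmodType R) (W : V -> Prop) (v : V) : submodule W -> dcc_in W ->
  dcc_in (fun x => exists2 r : R, True & W (x - r *: v)).
Proof.
move=> hW dW U hU sub dec.
have [n|n x []//|n x [/dec ? ?]//|N1 hN1] := dW (fun n x => U n x /\ W x).
  split=> [|a x y [x1 x2] [y1 y2]]; first by split; exact: submodule0.
  by split; [apply: (proj2 (hU n)) | apply: (proj2 hW)].
have [n|//|n r [w hw hu]|N2 hN2] :=
    artinian_dcc (U := fun n r => exists2 w, W w & U n (r *: v + w)).
- split=> [|a r s [w hw hr] [w' hw' hs]].
    by exists 0; [exact: submodule0 | rewrite scale0r addr0; exact: submodule0 (hU n)].
  exists (a *: w + w'); first exact: (proj2 hW).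
  have := proj2 (hU n) a _ _ hr hs.
  by rewrite scalerDl scalerDr addrACA scalerA.
- by exists w => //; apply: dec.
exists (maxn N1 N2) => n; rewrite geq_max => /andP[le1 le2] x hx.
have [r _ hr] := sub _ _ hx.
have [|w hw hu] := hN2 n le2 r.
  exists (x - r *: v) => //; rewrite addrC subrK.
  by apply: (chain_le dec) hx; rewrite leq_maxr.
have -> : x = (x - (r *: v + w)) + (r *: v + w) by rewrite subrK.
apply: (submoduleD (hU n)) => //.
have wx : W (x - (r *: v + w)) by rewrite opprD addrA; apply: submoduleB.
suff [] : U n (x - (r *: v + w)) /\ W (x - (r *: v + w)) by [].
apply: hN1 => //; split=> //; apply: (submoduleB (hU N1)).
  by apply: (chain_le dec) hx; rewrite leq_maxl.
exact: chain_le dec le1 _ hu.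
Qed.

Lemma fg_dcc (V : lmodType R) : fg (V : ModR R) -> dcc V.
Proof.
case=> n [v gen]; suff h : dcc_in (fun x => exists c : 'I_n -> R, x = \sum_i c i *: v i).
  by move=> U hU _; apply: h => // k x _; apply: gen.
elim: n v {gen} => [|n IH] v.
  move=> U hU sub dec; exists 0%N => n _ x /sub[c ->].
  by rewrite big_ord0; apply: submodule0.
have hW : submodule (fun x => exists c : 'I_n -> R, x = \sum_i c i *: v (lift ord0 i)).
  split=> [|a x y [c ->] [d ->]].
    by exists (fun=> 0); rewrite big1 // => i _; rewrite scale0r.
  exists (fun i => a * c i + d i); rewrite scaler_sumr -big_split /=.
  by apply: eq_bigr => i _; rewrite scalerDl scalerA.
have h := @dcc_in_extend _ _ (v ord0) hW (IH _).
move=> U hU sub; apply: h => // k x /sub[c ->]; exists (c ord0) => //.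
by exists (fun i => c (lift ord0 i)); rewrite big_ord_recl addrC addKr.
Qed.
End FinitelyGenerated.

Section TopSeparation.
Variable A : pzRingType.
Implicit Types L K : (A^o : lmodType A) -> Prop.

Definition maximal_left_ideal L :=
  [/\ submodule L, ~ L 1 &
    forall L', submodule L' -> (forall x, L x -> L' x) -> ~ L' 1 -> forall x, L' x -> L x].

Lemma left_ideal1 L : submodule L -> L 1 -> forall x, L x.
Proof. by move=> hL h1 x; have := submoduleZ hL x h1; rewrite /GRing.scale /= mulr1. Qed.

Lemma maximal_left_ideal_ex K : submodule K -> ~ K 1 ->
  exists L, maximal_left_ideal L /\ forall x, K x -> L x.
Proof.
move=> hK nK1.
pose good L := [/\ submodule L, ~ L 1 & forall x, K x -> L x].
(* The empty set is allowed because the union of the empty chain is empty. *)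
have [F hF tot|L [hL maxL]] := @Zorn_bigcup A (fun L => L = set0 \/ good L).
  have [[L0 [FL0 gL0]]|none] := pselect (exists L, F L /\ good L); last first.
    left; apply/seteqP; split=> // x [L FL Lx].
    case: (hF L FL) => [e|g]; first by rewrite e in Lx.
    by case: none; exists L.
  right; split; last by move=> x Kx; exists L0 => //; case: gL0 => _ _ /(_ x Kx).
    split; first by exists L0 => //; case: gL0 => /submodule0.
    move=> a x y [L FL Lx] [L' FL' Lx'].
    have [] : (L `<=` L')%classic \/ (L' `<=` L)%classic by apply: tot.
      move=> /(_ _ Lx) h; exists L' => //; case: (hF L' FL') => [e|[g _ _]].
        by rewrite e in h.
      exact: (proj2 g).
    move=> /(_ _ Lx') h; exists L => //; case: (hF L FL) => [e|[g _ _]].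
      by rewrite e in h.
    exact: (proj2 g).
  by case=> L FL L1; case: (hF L FL) => [e|[_ n _]]; [rewrite e in L1|apply: n].
have {hL} [sL nL KL] : good L.
  case: hL => // L0; case: (maxL K); last by right; split.
  by rewrite L0 properEneq; split=> //; apply/eqP => e; have := submodule0 hK; rewrite -e.
exists L; split=> //; split=> // L' hL' sub nL'1 x L'x; apply: contrapT => nLx.
apply: (maxL L'); last by right; split=> // y /KL/sub.
by split=> // /(_ _ L'x).
Qed.

(** For a proper left ideal [K], the simple quotients of [A / K] occur in the socle
    of [A / rad A]; concretely some right multiplication by [t] maps [K] into the
    radical without [t] lying in it.  With [T] minimal such that [T + K = A], the
    intersection of [T] and [K] lies in every maximal [S], since otherwise [S], by
    the modular law, would cut [T] down; so [t] can be read off from [1 = t + k]. *)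
Lemma top_separation K : dcc (A^o : lmodType A) -> submodule K -> ~ K 1 ->
  exists t : A, (exists2 L, maximal_left_ideal L & ~ L t) /\
    forall L, maximal_left_ideal L -> forall k : A, K k -> L (k * t).
Proof.
move=> hA hK nK1.
pose F T := submodule T /\ forall x, exists2 k, K k & T (x - k).
have [T [] //||T [hT TK] minT] := dcc_min (F := F) hA.
  by exists (fun=> True); split=> // x; exists 0 => //; apply: submodule0 hK.
have [k Kk Tt] := TK 1; exists (1 - k); split.
  have [L [mL KL]] := maximal_left_ideal_ex hK nK1; exists L => // Lt.
  case: mL => hL nL1 _; apply: nL1; rewrite -[1](subrK k).
  by apply: (submoduleD hL) => //; apply: KL.
move=> S mS a Ka; have [hS nS1 mxS] := mS.
suff TKS : forall x, T x -> K x -> S x.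
  apply: TKS; first exact: (submoduleZ hT a Tt).
  by rewrite mulrBr mulr1; apply: (submoduleB hK) => //; exact: (submoduleZ hK a Kk).
move=> b Tb Kb; apply: contrapT => nSb.
(* [S'] is the sum of [S] and the intersection of [T] and [K]; it exceeds [S]. *)
pose S' x := exists2 y, T y /\ K y & S (x - y).
have hS' : submodule S'.
  split; first by exists 0; [split; exact: submodule0|rewrite subrr; exact: submodule0].
  move=> c x y [u [u1 u2] hx] [v [v1 v2] hy]; exists (c *: u + v).
    by split; [apply: (proj2 hT) | apply: (proj2 hK)].
  by rewrite opprD addrACA -scalerBr; apply: (proj2 hS).
have S'1 : S' 1.
  apply: contrapT => nS'1; apply: nSb; apply: (mxS S') => //.
    by move=> x Sx; exists 0; [split; exact: submodule0|rewrite subr0].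
  by exists b => //; rewrite subrr; exact: submodule0.
have allS' := left_ideal1 hS' S'1.
(* By the modular law the intersection of [T] and [S] still supplements [K]. *)
apply: nSb; suff [] : T b /\ S b by [].
apply: (minT (fun x => T x /\ S x)) => //; last by move=> x [].
split.
  split=> [|c x y [x1 x2] [y1 y2]]; first by split; exact: submodule0.
  by split; [apply: (proj2 hT) | apply: (proj2 hS)].
move=> x; have [k' Kk' Tx] := TK x.
have [y [Ty Ky] Sy] := allS' (x - k').
exists (k' + y); first exact: (submoduleD hK).
by rewrite opprD addrA; split=> //; apply: (submoduleB hT).
Qed.
End TopSeparation.

(** * Linear maps between modules *)

Section LinearMaps.
Variable A : pzRingType.
Implicit Types U V W Q M E : lmodType A.

(** A transparent alias that carries the proof of linearity, for building linear maps
    inside proofs. *)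
Definition linmap U V (f : U -> V) (_ : linear f) : U -> V := f.
HB.instance Definition _ U V (f : U -> V) (hf : linear f) :=
  GRing.isLinear.Build A U V *:%R (linmap hf) hf.
Definition mklin U V (f : U -> V) (hf : linear f) : {linear U -> V} := linmap hf.

Lemma linear_app U V (f g : {linear U -> V}) : f = g -> forall x, f x = g x.
Proof. by move=> ->. Qed.

Lemma linear_factor U Q W (p : {linear U -> Q}) (g : {linear U -> W}) :
  (forall q, exists x, p x = q) -> (forall x, p x = 0 -> g x = 0) ->
  exists h : {linear Q -> W}, forall x, h (p x) = g x.
Proof.
move=> /choice[s ps] ker.
have hE x : g (s (p x)) = g x.
  by apply/eqP; rewrite -subr_eq0 -linearB ker // linearB /= ps subrr.
have lin : linear (fun q => g (s q)).
  by move=> a x y; rewrite -(ps x) -(ps y) -linearP !hE linearP.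
by exists (mklin lin).
Qed.

Lemma linear_lift U V W (m : {linear V -> W}) (g : {linear U -> W}) :
  injective m -> (forall x, exists y, m y = g x) ->
  exists h : {linear U -> V}, forall x, m (h x) = g x.
Proof.
move=> inj /choice[h mh].
have lin : linear h by move=> a x y; apply: inj; rewrite linearP !mh linearP.
by exists (mklin lin).
Qed.

Lemma linear_inj0 U V (f : {linear U -> V}) :
  (forall x, f x = 0 -> x = 0) -> injective f.
Proof.
by move=> h x y /eqP; rewrite -subr_eq0 -linearB => /eqP/h/eqP; rewrite subr_eq0 => /eqP.
Qed.

Lemma ker_submodule U V (f : {linear U -> V}) : submodule (fun x => f x = 0).
Proof.
by split=> [|a x y hx hy]; [exact: raddf0 | rewrite linearP hx hy scaler0 addr0].
Qed.

Lemma im_submodule U V (f : {linear U -> V}) : submodule (fun y => exists x, f x = y).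
Proof.
split=> [|a _ _ [x <-] [y <-]]; first by exists 0; exact: raddf0.
by exists (a *: x + y); rewrite linearP.
Qed.

Section Projection.
Variables (M : lmodType A) (N : submodClosed M).
Local Notation Q := {ideal_quot (modsub N)}.

Definition modproj_fun (x : M) : modquot N := \pi_Q x.
Lemma modproj_linear : linear modproj_fun.
Proof.
move=> a x y; rewrite /modproj_fun raddfD; congr (_ + _).
exact/esym/modquot_scaleE.
Qed.
HB.instance Definition _ := GRing.isLinear.Build A M (modquot N) *:%R modproj_fun modproj_linear.
Definition modproj : {linear M -> modquot N} := modproj_fun.

Lemma modproj_surj q : exists x, modproj x = q.
Proof. by exists (repr (q : Q)); exact: reprK. Qed.

Lemma modproj_eq0 x : modproj x = 0 <-> x \in N.
Proof.
have -> : (x \in N) = (x - 0 \in modsub N) by rewrite subr0.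
rewrite Quotient.idealrBE; split=> [h|/eqP h].
  by apply/eqP; rewrite (_ : \pi_Q 0 = 0) //; exact: raddf0.
by rewrite /modproj /= /modproj_fun h; exact: raddf0.
Qed.
End Projection.

(** Tested on the free module of rank one, which represents the elements. *)
Lemma mono_injective U V (f : {linear U -> V}) :
  is_mono (f : @mor (ModR A) U V) <-> injective f.
Proof.
split=> [mf|inj Z g h /linear_app e]; last first.
  by apply: linear_ext => x; apply: inj; exact: e.
apply: linear_inj0 => x fx.
have lin : linear (fun a : (A^o : lmodType A) => a *: x).
  by move=> a b c; rewrite scalerDl scalerA.
have lin0 : linear (fun a : (A^o : lmodType A) => 0 : U).
  by move=> a b c; rewrite scaler0 addr0.
have /linear_app/(_ 1) : mklin lin = mklin lin0.
  apply: (mf (A^o : lmodType A)); apply: linear_ext => a /=.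
  by rewrite /linmap linearZ_LR fx; exact: etrans (scaler0 _ _) (esym (raddf0 f)).
by rewrite /mklin /= /linmap scale1r.
Qed.

(** Tested on the projection to the cokernel and on zero. *)
Lemma epi_surjective U V (f : {linear U -> V}) :
  is_epi (f : @mor (ModR A) U V) <-> forall y, exists x, f x = y.
Proof.
split=> [ef y|surj Z g h /linear_app e]; last first.
  by apply: linear_ext => y; case: (surj y) => x <-; exact: e.
pose N := submod_of (im_submodule f).
have lin0 : linear (fun a : V => 0 : modquot N).
  by move=> a b c; rewrite scaler0 addr0.
have /linear_app/(_ y) : modproj N = mklin lin0.
  apply: ef; apply: linear_ext => x; apply/modproj_eq0/in_submod_of.
  by exists x.
by move/modproj_eq0/in_submod_of.
Qed.

(** Injectivity for maps [f] that need not be injective: both [f] and [g] factor through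
    the quotient by the kernel of [f]. *)
Lemma injective_extend U V E (f : {linear U -> V}) (g : {linear U -> E}) :
  injective_in (@everything (ModR A)) E -> (forall x, f x = 0 -> g x = 0) ->
  exists h : {linear V -> E}, forall x, h (f x) = g x.
Proof.
move=> [_ injE] ker; pose N := submod_of (ker_submodule f).
have kerN x : modproj N x = 0 <-> f x = 0 by rewrite modproj_eq0 in_submod_of.
have [f' f'E] := linear_factor (@modproj_surj _ N) (fun x => proj1 (kerN x)).
have [g' g'E] := linear_factor (@modproj_surj _ N) (fun x h => ker x (proj1 (kerN x) h)).
have /mono_injective mf' : injective f'.
  apply: linear_inj0 => q; have [x <-] := modproj_surj q.
  by rewrite f'E => /kerN.
have [h /linear_app hE] := injE _ _ I I f' g' mf'.
exists h => x; rewrite -f'E -g'E.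
exact: hE.
Qed.

Lemma fg_quotient U V (f : {linear U -> V}) :
  (forall y, exists x, f x = y) -> fg (U : ModR A) -> fg (V : ModR A).
Proof.
move=> surj [n [v gen]]; exists n, (fun i => f (v i)) => y.
have [x <-] := surj y; have [c ->] := gen x; exists c.
by rewrite linear_sum; apply: eq_bigr => i _; rewrite linearZ.
Qed.

(** Both modules are identified with the common image in [W]. *)
Lemma isomorphic_same_image U V W (f : {linear U -> W}) (g : {linear V -> W}) :
  injective f -> injective g -> (forall x, exists y, g y = f x) ->
  (forall y, exists x, f x = g y) -> isomorphic (U : ModR A) (V : ModR A).
Proof.
move=> fi gi fg gf.
have [h hE] := linear_lift gi fg; have [k kE] := linear_lift fi gf.
exists h, k; split; apply: linear_ext => x /=; first by apply: fi; rewrite kE hE.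
by apply: gi; rewrite hE kE.
Qed.
End LinearMaps.

(** The cyclic submodule of [x] is [R] modulo the annihilator [K] of [x], and has a
    nonzero map to [R / rad R], which lies in [E]. *)
Lemma cogenerator (R : comPzRingType) (E : lmodType R)
    (eps : @mor (ModR R) (modquot (radm (R^o : lmodType R))) E) :
  artinian R -> injective_envelope_in (@everything (ModR R)) eps ->
  forall (V : lmodType R) (x : V), (forall f : {linear V -> E}, f x = 0) -> x = 0.
Proof.
move=> hR [/mono_injective epsI injE _] V x all0; apply: contrapT => nx0.
have lin : linear (fun a : (R^o : lmodType R) => a *: x).
  by move=> a b c; rewrite scalerDl scalerA.
have hK := ker_submodule (mklin lin).
have [|t [[L mL nLt] Kt]] := top_separation (artinian_dcc hR) hK.
  by rewrite /mklin /= /linmap scale1r.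
have lint : linear (fun a : (R^o : lmodType R) => eps (modproj _ (a * t : R^o))).
  move=> a b c; rewrite -!linearP; congr (eps (modproj _ _)).
  by rewrite mulrDl /GRing.scale /= mulrA.
have [|h hE] := injective_extend (f := mklin lin) (g := mklin lint) injE.
  move=> a ha; rewrite /mklin /= /linmap.
  rewrite (_ : modproj _ _ = 0) ?raddf0 //; apply/modproj_eq0/asboolP => N [[y yN] mN].
  apply: (Kt (fun z => z \in N)) => //; split; first exact: submodule_mem.
    by move=> N1; move: yN; rewrite (left_ideal1 (submodule_mem N) N1).
  move=> L' hL' sub nL'1 z L'z; apply: (mN (submod_of hL')).
  - by move=> w /sub /(in_submod_of hL').
  - by exists 1; apply/negP => /(in_submod_of hL').
  - exact/in_submod_of.
have := hE 1; rewrite /mklin /= /linmap scale1r all0 mul1r => /esym.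
rewrite -(raddf0 eps) => /epsI/modproj_eq0/asboolP rt.
have [hL nL1 mxL] := mL; apply: nLt; apply/(in_submod_of hL); apply: rt; split.
  by exists 1; apply/negP => /(in_submod_of hL).
move=> L' sub [y yL'] z zL'; apply/in_submod_of.
apply: (mxL (fun z => z \in L')) => //; first exact: submodule_mem.
  by move=> w Lw; apply: sub; apply/in_submod_of.
by move=> L'1; move: yL'; rewrite (left_ideal1 (submodule_mem L') L'1).
Qed.

(** * Equivalences of categories *)

Section Equivalences.
Variables (T S : category) (F : functor T S).

(** Up to the natural isomorphism, [G] recovers a morphism from its image under [F]. *)
Lemma faithful_of_retraction (G : functor S T) :
  nat_isomorphic (fcomp G F) (fid T) ->
  forall X Y (f g : mor X Y), fmor F f = fmor F g -> f = g.
Proof.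
move=> [eta [iso nat]] X Y f g e.
have [i [_ ei]] := iso X.
have /(congr1 (compc^~ i)) : f ∘ eta X = g ∘ eta X.
  by have := nat _ _ f; have := nat _ _ g; rewrite /= e => -> ->.
by rewrite /= -!compcA ei !compc1.
Qed.
End Equivalences.

Lemma equivalence_full_faithful (T S : category) (F : functor T S) :
  is_equivalence F ->
  [/\ forall X Y (f g : mor X Y), fmor F f = fmor F g -> f = g,
      forall X Y (g : mor (F X) (F Y)), exists f, fmor F f = g
    & forall Z : S, exists X, isomorphic (F X) Z].
Proof.
move=> [G [GF FG]]; split.
- exact: faithful_of_retraction GF.
- move=> X Y g; have [eta [iso nat]] := GF.
  have [i [ie ei]] := iso X; have [j [je _]] := iso Y.
  exists (eta Y ∘ fmor G g ∘ i); apply: (faithful_of_retraction FG).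
  have := congr1 (compc j) (nat _ _ (eta Y ∘ fmor G g ∘ i)).
  by rewrite /= -!compcA ie compc1 !compcA je !comp1c.
- by move=> Z; have [eps [iso _]] := FG; exists (G Z), (eps Z); exact: iso.
Qed.

(** The quasi-inverse picks a preimage of every object, and transports morphisms
    along the chosen isomorphisms. *)
Lemma full_faithful_equivalence (T S : category) (F : functor T S) :
  (forall X Y (f g : mor X Y), fmor F f = fmor F g -> f = g) ->
  (forall X Y (g : mor (F X) (F Y)), exists f, fmor F f = g) ->
  (forall Z : S, exists X, isomorphic (F X) Z) -> is_equivalence F.
Proof.
move=> faith full' ess.
have pre (Z : S) : exists p : {X : T & {u : mor (F X) Z & mor Z (F X)}},
    projT2 (projT2 p) ∘ projT1 (projT2 p) = idc _ /\
    projT1 (projT2 p) ∘ projT2 (projT2 p) = idc _.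
  by have [X [u [v uv]]] := ess Z; exists (existT _ X (existT _ u v)).
pose c Z := sval (cid (pre Z)).
have cE Z := svalP (cid (pre Z)).
pose G Z := projT1 (c Z).
pose u Z : mor (F (G Z)) Z := projT1 (projT2 (c Z)).
pose v Z : mor Z (F (G Z)) := projT2 (projT2 (c Z)).
have vu Z : v Z ∘ u Z = idc _ by case: (cE Z).
have uv Z : u Z ∘ v Z = idc _ by case: (cE Z).
pose lift X Y g := sval (cid (full' X Y g)).
have liftE X Y g : fmor F (lift X Y g) = g := svalP (cid (full' X Y g)).
have G1 Z : lift _ _ (v Z ∘ idc Z ∘ u Z) = idc (G Z).
  by apply: faith; rewrite liftE compc1 vu fmor1.
have GM Z1 Z2 Z3 (g : mor Z2 Z3) (f : mor Z1 Z2) :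
    lift _ _ (v Z3 ∘ (g ∘ f) ∘ u Z1) =
    lift _ _ (v Z3 ∘ g ∘ u Z2) ∘ lift _ _ (v Z2 ∘ f ∘ u Z1).
  apply: faith; rewrite fmorM !liftE !compcA -(compcA _ (u Z2) (v Z2)) uv.
  by rewrite compc1.
pose GG : functor S T := @Functor S T G (fun X Y f => lift _ _ (v Y ∘ f ∘ u X)) G1 GM.
exists GG; split.
  exists (fun X => lift _ _ (u (F X))); split=> [X|X Y f].
    exists (lift _ _ (v (F X))).
    by split; apply: faith; rewrite fmorM !liftE fmor1 ?vu ?uv.
  by apply: faith; rewrite /= !fmorM !liftE !compcA uv comp1c.
exists u; split=> [X|X Y f]; first by exists (v X); split; [exact: vu | exact: uv].
by rewrite /= liftE !compcA uv comp1c.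
Qed.

(** The criterion in the form in which all four equivalences are obtained. *)
Lemma induces_equivalence_intro (T S : category) (F : functor T S)
    (Q : T -> Prop) (Q' : S -> Prop) :
  (forall X, Q X -> Q' (F X)) ->
  (forall X Y, Q X -> Q Y -> bijective (@fmor T S F X Y)) ->
  (forall Z, Q' Z -> exists2 X, Q X & isomorphic (F X) Z) ->
  induces_equivalence F Q Q'.
Proof.
move=> FQ ff ess; exists FQ; apply: full_faithful_equivalence.
- move=> [X hX] [Y hY] f g /= e; exact: (bij_inj (ff X Y hX hY)) e.
- move=> [X hX] [Y hY] g /=; have [k _ kK] := ff X Y hX hY.
  by exists (k g); rewrite kK.
- move=> [Z hZ]; have [X hX [f [g gf]]] := ess Z hZ.
  by exists (exist _ X hX), f, g.
Qed.

Lemma inj_surj_bijective (U V : Type) (f : U -> V) :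
  injective f -> (forall y, exists x, f x = y) -> bijective f.
Proof. by move=> inj /choice[g gK]; exists g => // x; apply: inj; rewrite gK. Qed.

(** * Natural transformations, subfunctors and quotients *)

Section FunctorBasics.
Variables (R : comPzRingType) (C : rcategory R).
Implicit Types L M N X W Q : afunctor C.

Lemma nt_app M N (s t : nattrans M N) : s = t -> forall Y x, s Y x = t Y x.
Proof. by move=> ->. Qed.

Lemma nappN M N (s : nattrans M N) Y x : s Y (- x) = - s Y x.
Proof. by apply/eqP; rewrite -addr_eq0 -nappD addNr napp0. Qed.
Lemma nappB M N (s : nattrans M N) Y x y : s Y (x - y) = s Y x - s Y y.
Proof. by rewrite nappD nappN. Qed.
Lemma amap0 M Y Z (x : M Y) : amap M (0 : rhom Y Z) x = 0.
Proof. by apply: (addIr (amap M 0 x)); rewrite -amapD !add0r. Qed.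

Lemma ninj0 M N (s : nattrans M N) :
  (forall Y x, s Y x = 0 -> x = 0) -> ninjective s.
Proof.
move=> h Y x y e; apply/eqP; rewrite -subr_eq0; apply/eqP/(h Y).
by rewrite nappB e subrr.
Qed.

Lemma napp_sum M N (s : nattrans M N) Y n (f : 'I_n -> M Y) :
  s Y (\sum_i f i) = \sum_i s Y (f i).
Proof. by elim/big_ind2: _ => [|x1 x2 y1 y2 <- <-|//]; rewrite ?napp0 ?nappD.
Qed.
Lemma nt_sumE M N n (s : 'I_n -> nattrans M N) Y x :
  (\sum_i s i : nattrans M N) Y x = \sum_i s i Y x.
Proof.
by elim/big_ind2: _ => [//|x1 x2 y1 y2 <- <-|//].
Qed.

(** The Yoneda correspondence between elements of [M] at [Y] and transformations from
    the functor represented by [Y]. *)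
Definition yon M Y (x : M Y) : nattrans (repr_functor Y) M.
Proof.
exists (fun Z (f : rhom Y Z) => amap M f x).
- by move=> Z f g; rewrite amapD.
- by move=> Z W f g; rewrite /= amapM.
Defined.

Lemma yon_id M Y (x : M Y) : yon x Y (rid Y) = x.
Proof. exact: amap1. Qed.

Lemma yonE M Y (s : nattrans (repr_functor Y) M) : s = yon (s Y (rid Y)).
Proof. by apply: nattrans_ext => Z f /=; rewrite -nappE /= rcompr1. Qed.

Lemma yon_inj M Y (x y : M Y) : yon x = yon y -> x = y.
Proof. by move=> e; rewrite -(yon_id x) e yon_id. Qed.

Lemma ntcomp_yon M N Y (s : nattrans M N) (x : M Y) : ntcomp s (yon x) = yon (s Y x).
Proof. by apply: nattrans_ext => Z f /=; rewrite nappE. Qed.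

Lemma fp_repr Y : fp (repr_functor Y : ModC C).
Proof.
exists Y, Y, (nt0 _ _), (ntid _); split=> [Z f|Z f]; last by exists f.
by split=> [h|[_ <-]] //; exists 0; rewrite /= in h *; rewrite h.
Qed.

Lemma nat_factor X Q W (p : nattrans X Q) (g : nattrans X W) :
  nsurjective p -> (forall Y x, p Y x = 0 -> g Y x = 0) ->
  exists h : nattrans Q W, forall Y x, h Y (p Y x) = g Y x.
Proof.
move=> surj ker.
pose s Y q := sval (cid (surj Y q)).
have ps Y q : p Y (s Y q) = q := svalP (cid (surj Y q)).
have hE Y x : g Y (s Y (p Y x)) = g Y x.
  by apply/eqP; rewrite -subr_eq0 -nappB ker // nappB ps subrr.
have hD Y : {morph (fun q => g Y (s Y q)) : x y / x + y}.
  by move=> x y; rewrite -(ps _ x) -(ps _ y) -nappD !hE nappD.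
have hM Y Z (f : rhom Y Z) q : g Z (s Z (amap Q f q)) = amap W f (g Y (s Y q)).
  by rewrite -{1}(ps _ q) -nappE hE nappE.
by exists (NatTrans hD hM).
Qed.

Lemma nat_lift X V W (m : nattrans V W) (g : nattrans X W) :
  ninjective m -> (forall Y x, exists y, m Y y = g Y x) ->
  exists h : nattrans X V, forall Y x, m Y (h Y x) = g Y x.
Proof.
move=> inj im.
pose h Y x := sval (cid (im Y x)).
have mh Y x : m Y (h Y x) = g Y x := svalP (cid (im Y x)).
have hD Y : {morph h Y : x y / x + y} by move=> x y; apply: inj; rewrite nappD !mh nappD.
have hM Y Z (f : rhom Y Z) x : h Z (amap X f x) = amap V f (h Y x).
  by apply: inj; rewrite nappE !mh nappE.
by exists (NatTrans hD hM).
Qed.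

(** Tested on representable functors. *)
Lemma nmono_injective M N (s : nattrans M N) :
  is_mono (s : @mor (ModC C) M N) <-> ninjective s.
Proof.
split=> [ms|inj Z g h e]; last first.
  apply: nattrans_ext => Y x; apply: inj.
  exact: (nt_app e x).
apply: ninj0 => Y x sx; rewrite -(yon_id x).
have -> : yon x = nt0 _ _.
  apply: (ms (repr_functor Y)); apply: nattrans_ext => Z f /=.
  by rewrite nappE sx amap_el0 napp0.
by [].
Qed.

(** As for modules, subfunctors are given by propositional predicates and packed by
    [mksub]. *)
Definition subclosed M (S : forall Y, M Y -> Prop) :=
  [/\ forall Y, S Y 0, forall Y x y, S Y x -> S Y y -> S Y (x - y)
    & forall Y Z (f : rhom Y Z) x, S Y x -> S Z (amap M f x)].

Section MkSub.
Variables (M : afunctor C) (S : forall Y, M Y -> Prop) (hS : subclosed S).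
Definition mksub_mem Y : {pred M Y} := fun x => `[< S x >].
Arguments mksub_mem : clear implicits.
Lemma mksub_zmod Y : zmod_closed (mksub_mem Y).
Proof.
have [h0 hB _] := hS; split=> [|x y /asboolP hx /asboolP hy]; apply/asboolP => //.
exact: hB.
Qed.
HB.instance Definition _ Y := GRing.isZmodClosed.Build (M Y) (mksub_mem Y) (mksub_zmod Y).
Definition mksub : subfunctor M.
Proof.
exists (fun Y => mksub_mem Y : zmodClosed (M Y)) => Y Z f x /asboolP hx.
by apply/asboolP; case: hS => _ _; apply.
Defined.
Lemma in_mksub Y (x : M Y) : (x \in mksub Y) <-> S x.
Proof. by split=> [/asboolP|h]; last apply/asboolP. Qed.
End MkSub.

Section SubQuo.
Variables (M : afunctor C) (T : subfunctor M).
Definition subz Y : Type := {x : M Y | x \in T Y}.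
HB.instance Definition _ Y := SubChoice.on (subz Y).
HB.instance Definition _ Y := [SubChoice_isSubZmodule of subz Y by <:].

Definition sub_functor : afunctor C.
Proof.
apply: (@AFunctor R C (fun Y => subz Y)
  (fun Y Z f x => exist _ (amap M f (sval x)) (smap f (svalP x)))).
- by move=> Y Z f x y; apply: (@val_inj _ _ (subz Z)) => /=; rewrite !amap_elD.
- by move=> Y Z f g x; apply: (@val_inj _ _ (subz Z)) => /=; rewrite !amapD.
- by move=> Y x; apply: (@val_inj _ _ (subz Y)) => /=; rewrite amap1.
- by move=> Y Z W g f x; apply: (@val_inj _ _ (subz W)) => /=; rewrite amapM.
Defined.

Definition sub_incl : nattrans sub_functor M.
Proof. by exists (fun Y (x : subz Y) => sval x). Defined.

Lemma sub_incl_inj : ninjective sub_incl.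
Proof. by move=> Y; exact: val_inj. Qed.

Lemma sub_incl_im Y (x : M Y) : (x \in T Y) <-> exists y, sub_incl Y y = x.
Proof. by split=> [h|[y <-]]; [exists (exist _ x h) | exact: (svalP (y : subz Y))]. Qed.

Definition quo_proj : nattrans M (quo_functor T).
Proof.
exists (fun Y x => \pi_{ideal_quot (T Y)} x).
- by move=> Y x y; rewrite raddfD.
- by move=> Y Z f x; exact/esym/quo_mapE.
Defined.

Lemma quo_proj_surj : nsurjective quo_proj.
Proof. by move=> Y q; exists (repr (q : {ideal_quot (T Y)})); exact: reprK. Qed.

Lemma quo_proj_eq0 Y (x : M Y) : quo_proj Y x = 0 <-> x \in T Y.
Proof.
rewrite -{2}[x]subr0 Quotient.idealrBE; split=> [h|/eqP h].
  by apply/eqP; rewrite (_ : \pi_{ideal_quot (T Y)} 0 = 0) //; exact: raddf0.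
by rewrite /= h; exact: raddf0.
Qed.
End SubQuo.

Lemma ker_subclosed M N (s : nattrans M N) : subclosed (fun Y x => s Y x = 0).
Proof.
split=> [Y|Y x y hx hy|Y Z f x hx]; first exact: napp0.
  by rewrite nappB hx hy subrr.
by rewrite nappE hx amap_el0.
Qed.

Lemma im_subclosed M N (s : nattrans M N) : subclosed (fun Y y => exists x, s Y x = y).
Proof.
split=> [Y|Y _ _ [x <-] [y <-]|Y Z f _ [x <-]]; first by exists 0; exact: napp0.
  by exists (x - y); rewrite nappB.
by exists (amap M f x); rewrite nappE.
Qed.

Lemma nepi_surjective M N (s : nattrans M N) :
  is_epi (s : @mor (ModC C) M N) -> nsurjective s.
Proof.
move=> es Y y; apply/(in_mksub (im_subclosed s))/quo_proj_eq0.
have -> : quo_proj (mksub (im_subclosed s)) = nt0 _ _; last by [].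
apply: es; apply: nattrans_ext => Z x.
by apply/quo_proj_eq0/in_mksub; exists x.
Qed.

Lemma repr_projective Y : projective_in (@fp R C) (repr_functor Y).
Proof.
split=> [|A B _ _ e f /nepi_surjective surj]; first exact: fp_repr.
have [x ex] := surj _ (f Y (rid Y)).
by exists (yon x : nattrans _ A); rewrite [f]yonE -ex; exact: ntcomp_yon.
Qed.

Lemma fp_iso M N : isomorphic (M : ModC C) N -> fp (M : ModC C) -> fp (N : ModC C).
Proof.
move=> [f [g [gf fg]]] [C1 [C0 [d [e [ex surj]]]]].
have gfE Y x : g Y (f Y x) = x := nt_app gf x.
have fgE Y x : f Y (g Y x) = x := nt_app fg x.
exists C1, C0, d, (ntcomp f e); split=> [Y h|Y y]; last first.
  by have [h eh] := surj Y (g Y y); exists h; rewrite /= eh fgE.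
rewrite -ex /=; split=> [h0|->]; last exact: napp0.
by rewrite -(gfE _ (e Y h)) h0 napp0.
Qed.
End FunctorBasics.

(** * Duality *)

Section Codual.
Variables (R : comPzRingType) (E : lmodType R) (C : rcategory R).

Definition lapp (U V : lmodType R) (f : linhom U V) : U -> V := (f : {linear U -> V}).

Lemma lapp_ext (U V : lmodType R) (f g : linhom U V) : lapp f =1 lapp g -> f = g.
Proof. exact: linear_ext. Qed.

Lemma rvalZ (D : rcategory R) (M : afunctor D) Y (r : R) (x : rval M Y) :
  r *: x = amap M (r *: rid Y) x.
Proof. by []. Qed.

(** The duality in the opposite direction.  It is not an instance of [dual_functor],
    since the opposite of [rop C] is not convertible to [C]. *)
Definition codual_functor (N : afunctor (rop C)) : afunctor C.
Proof.
apply: (@AFunctor R C (fun X => linhom (@rval R (rop C) N X) E)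
  (fun (X Y : C) (f : rhom X Y) phi => lcomp phi (@amapL R (rop C) N Y X f))).
- by move=> X Y f phi psi; apply: linear_ext.
- move=> X Y f g phi; apply: linear_ext => x /=.
  by rewrite /amapL amapD -raddfD.
- by move=> X phi; apply: linear_ext => x /=; rewrite /amapL (@amap1 R (rop C)).
- by move=> X Y Z g f phi; apply: linear_ext => x /=; rewrite /amapL (@amapM R (rop C)).
Defined.

Implicit Types (X M : afunctor C) (N : afunctor (rop C)).

(** The dualities are adjoint on the right: transformations from [X] to the codual of
    [N] and from [N] to the dual of [X] are both pairings of [X] and [N] into [E]. *)
Section Transpose.
Variables (X : afunctor C) (N : afunctor (rop C)).

Section ToCodual.
Variable s : nattrans N (dual_functor E X).
Lemma transpose_linear Y (x : X Y) :
  linear (fun n : @rval R (rop C) N Y => lapp (s Y n) (x : rval X Y)).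
Proof.
move=> r n m; rewrite (nappD s); congr (_ + _).
rewrite rvalZ (@nappE R (rop C) _ _ s) /lapp /= /amapL.
exact: (linearZ_LR (s Y n : {linear rval X Y -> E}) r x).
Qed.
Definition transpose : nattrans X (codual_functor N).
Proof.
exists (fun Y x => mklin (transpose_linear x)).
- move=> Y x y; apply: linear_ext => n.
  exact: (raddfD (s Y n : {linear rval X Y -> E}) x y).
- move=> Y Z f x; apply: linear_ext => n.
  by rewrite /= /linmap /amapL (@nappE R (rop C) _ _ s).
Defined.
End ToCodual.

Section ToDual.
Variable s : nattrans X (codual_functor N).
Lemma untranspose_linear Y (n : N Y) : linear (fun x : rval X Y => lapp (s Y x) n).
Proof.
move=> r x y; rewrite nappD; congr (_ + _).
rewrite rvalZ nappE /lapp /= /amapL.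
exact: (linearZ_LR (s Y x : {linear rval N Y -> E}) r n).
Qed.
Definition untranspose : nattrans N (dual_functor E X).
Proof.
exists (fun Y n => mklin (untranspose_linear n)).
- move=> Y m n; apply: linear_ext => x.
  exact: (raddfD (s Y x : {linear rval N Y -> E}) m n).
- move=> Y Z f n; apply: linear_ext => x.
  by rewrite /= /linmap /amapL nappE.
Defined.
Lemma untransposeE Y (x : X Y) (n : N Y) : lapp (untranspose Y n) x = lapp (s Y x) n.
Proof. by []. Qed.
End ToDual.
End Transpose.

Definition codual_nattrans N N' (s : nattrans N N') :
  nattrans (codual_functor N') (codual_functor N).
Proof.
exists (fun (Y : C) phi => lcomp phi (@nappL R (rop C) N N' s Y)).
- by move=> Y phi psi; apply: linear_ext.
- move=> Y Z f phi; apply: linear_ext => x /=.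
  by rewrite /amapL /nappL (@nappE R (rop C) _ _ s).
Defined.

Definition bidual M : nattrans M (codual_functor (dual_functor E M)) :=
  transpose (ntid (dual_functor E M)).

Lemma bidualE M Y (x : M Y) (phi : dual_functor E M Y) : lapp (bidual M Y x) phi = lapp phi x.
Proof. by []. Qed.

(** An injective functor: maps into it are functionals on the value at [Z], by [coyon]
    and [corepr_ext]. *)
Definition corepr (Z : C) : afunctor C := codual_functor (@repr_functor R (rop C) Z).

Lemma corepr_amap Z Y Y' (f : rhom Y Y') (phi : corepr Z Y) (g : rhom Y' Z) :
  lapp (amap (corepr Z) f phi) g = lapp phi (g ⊚ f).
Proof. by []. Qed.

(** The component at [Z], evaluated at the identity, determines a transformation. *)
Lemma corepr_app M Z (s : nattrans M (corepr Z)) Y (x : M Y) (g : rhom Y Z) :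
  lapp (s Y x) g = lapp (s Z (amap M g x)) (rid Z).
Proof. by rewrite nappE corepr_amap rcomp1l. Qed.

Lemma corepr_ext M Z (s t : nattrans M (corepr Z)) :
  (forall x : M Z, lapp (s Z x) (rid Z) = lapp (t Z x) (rid Z)) -> s = t.
Proof.
move=> st; apply: nattrans_ext => Y x; apply: lapp_ext => g.
by rewrite (corepr_app s) (corepr_app t) st.
Qed.

(** The transformation into [corepr Z] with a prescribed functional at [Z]. *)
Definition coyon M Z (phi : {linear rval M Z -> E}) : nattrans M (corepr Z) :=
  transpose (@yon R (rop C) (dual_functor E M) Z phi).

Lemma coyonE M Z (phi : {linear rval M Z -> E}) Y (x : M Y) (g : rhom Y Z) :
  lapp (coyon phi Y x) g = phi (amap M g x).
Proof. by []. Qed.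

Lemma corepr_linear M Z (s : nattrans M (corepr Z)) :
  linear (fun x : rval M Z => lapp (s Z x) (rid Z)).
Proof. exact: (untranspose_linear s (rid Z : @repr_functor R (rop C) Z Z)). Qed.

(** Subfunctors of [corepr Z] that vanish at [Z] are zero. *)
Lemma corepr_eq0 Z Y (phi : corepr Z Y) :
  (forall g : rhom Y Z, amap (corepr Z) g phi = 0) -> phi = 0.
Proof.
move=> h; apply: lapp_ext => g.
by have := congr1 (fun k : corepr Z Z => lapp k (rid Z)) (h g); rewrite corepr_amap rcomp1l.
Qed.

Hypothesis injE : injective_in (@everything (ModR R)) E.

(** [corepr Z] is injective among all functors, since [E] is injective and only the
    values at [Z] have to be extended. *)
Lemma corepr_extend M W Z (f : nattrans M W) (g : nattrans M (corepr Z)) :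
  (forall x : M Z, f Z x = 0 -> g Z x = 0) ->
  exists h : nattrans W (corepr Z), forall Y x, h Y (f Y x) = g Y x.
Proof.
move=> ker.
have [|phi phiE] := injective_extend (f := mklin (@napp_linear R C _ _ f Z))
   (g := mklin (corepr_linear g)) injE.
  by move=> x fx; rewrite /mklin /= /linmap (ker _ fx).
exists (coyon phi) => Y x.
suff -> : g = ntcomp (coyon phi) f by [].
apply: corepr_ext => y; rewrite -[RHS]/(lapp (coyon phi Z (f Z y)) (rid Z)) coyonE amap1.
exact/esym/phiE.
Qed.
End Codual.

(** * Kernels and cokernels of finitely presented functors *)

Section Cokernel.
Variables (R : comPzRingType) (D : rcategory R).

Lemma rcompDl (X Y Z : D) (g h : rhom Y Z) (f : rhom X Y) : (g + h) ⊚ f = g ⊚ f + h ⊚ f.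
Proof. by have := rcomp_linl f 1 g h; rewrite !scale1r. Qed.
Lemma rcompDr (X Y Z : D) (g : rhom Y Z) (f h : rhom X Y) : g ⊚ (f + h) = g ⊚ f + g ⊚ h.
Proof. by have := rcomp_linr g 1 f h; rewrite !scale1r. Qed.
Lemma rcomp0l (X Y Z : D) (f : rhom X Y) : (0 : rhom Y Z) ⊚ f = 0.
Proof. by apply: (addIr (0 ⊚ f)); rewrite -rcompDl !add0r. Qed.
Lemma rcomp0r (X Y Z : D) (g : rhom Y Z) : g ⊚ (0 : rhom X Y) = 0.
Proof. by apply: (addIr (g ⊚ 0)); rewrite -rcompDr !add0r. Qed.
Lemma rcomp_suml (X Y Z : D) n (g : 'I_n -> rhom Y Z) (f : rhom X Y) :
  (\sum_i g i) ⊚ f = \sum_i g i ⊚ f.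
Proof. by elim/big_ind2: _ => [|x1 x2 y1 y2 <- <-|//]; rewrite ?rcomp0l ?rcompDl.
Qed.
Lemma rcomp_sumr (X Y Z : D) n (g : rhom Y Z) (f : 'I_n -> rhom X Y) :
  g ⊚ (\sum_i f i) = \sum_i g ⊚ f i.
Proof. by elim/big_ind2: _ => [|x1 x2 y1 y2 <- <-|//]; rewrite ?rcomp0r ?rcompDr.
Qed.

Lemma napp_repr (M : afunctor D) X Y (s : nattrans (repr_functor X) M) (f : rhom X Y) :
  s Y f = amap M f (s X (rid X)).
Proof. by rewrite [in LHS](yonE s). Qed.

(** If [e'] covers [X] by a representable and [c] lifts [f] along it, then [c] joins
    the relations of [Y] in a presentation of the cokernel. *)
Lemma cokernel_fp (X Y : afunctor D) (f : nattrans X Y) : has_biproducts D ->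
    fp (X : ModC D) -> fp (Y : ModC D) ->
  exists (W : afunctor D) (p : nattrans Y W),
    [/\ fp (W : ModC D), nsurjective p & exact_at f p].
Proof.
move=> bip [_ [C' [_ [e' [_ surj']]]]] [C1 [C0 [d [e [ex surj]]]]].
have [c ec] := surj _ (f _ (e' _ (rid C'))).
pose T := mksub (im_subclosed f); pose p := quo_proj T.
have exp : exact_at f p.
  by move=> Z y; rewrite quo_proj_eq0 (in_mksub (im_subclosed f)).
exists (quo_functor T), p; split=> //; last exact: quo_proj_surj.
have [Z [i [j [p1 [q1 [pi qj pj qi _]]]]]] := bip C1 C'.
pose del := d _ (rid C1).
exists Z, C0, (yon (i ⊚ del + j ⊚ c : repr_functor C0 Z)), (ntcomp p e); split.
  move=> A h; rewrite [ntcomp p e A h]/= exp; split=> [[x fx]|[m <-]].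
    have [k ek] := surj' _ x.
    have : e A (h - k ⊚ c) = 0.
      rewrite nappB -fx -ek (napp_repr e') nappE -ec -nappE.
      exact: subrr.
    move=> /ex [l dl]; exists (k ⊚ q1 + l ⊚ p1) => /=.
    rewrite rcompDl !rcompDr -!rcompA (rcompA q1) (rcompA q1) (rcompA p1) (rcompA p1).
    rewrite qi qj pi pj !rcomp0l !rcomp1l !rcomp0r add0r addr0.
    have dlE : l ⊚ del = h - k ⊚ c by rewrite -dl (napp_repr d).
    by rewrite dlE addrC subrK.
  rewrite /= rcompDr !rcompA nappD.
  have -> : e A (m ⊚ i ⊚ del) = 0.
    by apply/ex; exists (m ⊚ i); rewrite (napp_repr d).
  exists (e' A (m ⊚ j)); rewrite add0r (napp_repr e') nappE -ec -nappE //.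
move=> A w; have [y <-] := quo_proj_surj w; have [h <-] := surj _ y.
by exists h.
Qed.

End Cokernel.

Section Dualizing.
Variables (R : comPzRingType) (E : lmodType R) (C : rcategory R).
Hypothesis hC : dualizing C E.
Implicit Types (X Y M W : afunctor C) (N : afunctor (rop C)).
Local Notation corepr := (corepr E).
Local Notation D := (dual_functor E).

Lemma dualizing_biproducts : has_biproducts C. Proof. by have [[]] := hC. Qed.

Lemma dualizing_biproducts_op : has_biproducts (rop C).
Proof.
move=> X Y; have [Z [i [j [p [q [pi qj pj qi e]]]]]] := dualizing_biproducts X Y.
by exists Z, p, q, i, j; split.
Qed.

Lemma dual_fp M : fp (M : ModC C) -> fp (D M : ModC (rop C)).
Proof. by have [_ [FQ _]] := hC; exact: FQ. Qed.

Lemma dual_full M W (t : nattrans (D W) (D M)) : fp (M : ModC C) -> fp (W : ModC C) ->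
  exists s : nattrans M W, dual_nattrans E s = t.
Proof.
move=> hM hW; have [_ [FQ /equivalence_full_faithful [_ full' _]]] := hC.
exact: (full' (exist _ W hW) (exist _ M hM) t).
Qed.

Lemma dual_faithful M W (s t : nattrans M W) : fp (M : ModC C) -> fp (W : ModC C) ->
  dual_nattrans E s = dual_nattrans E t -> s = t.
Proof.
move=> hM hW e; have [_ [FQ /equivalence_full_faithful [faith _ _]]] := hC.
exact: (faith (exist _ W hW) (exist _ M hM) s t).
Qed.

Lemma dual_ess N : fp (N : ModC (rop C)) ->
  exists2 M, fp (M : ModC C) & isomorphic (D M : ModC (rop C)) N.
Proof.
move=> hN; have [_ [FQ /equivalence_full_faithful [_ _ ess]]] := hC.
have [[M hM] [f [g gf]]] := ess (exist _ N hN).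
by exists M => //; exists f, g.
Qed.

(** Finitely presented functors are reflexive because the duality is fully faithful:
    an element of the bidual at [Y] is a transformation from the dual of [M] to the
    dual of a representable, and these come from elements of [M] at [Y]. *)
Lemma bidual_inj M : fp (M : ModC C) -> ninjective (bidual E M).
Proof.
move=> hM; apply: ninj0 => Y y by0; apply: yon_inj.
apply: dual_faithful => //; first exact: fp_repr.
apply: nattrans_ext => Z phi; apply: lapp_ext => f.
have := congr1 (fun k : codual_functor E (D M) Y => lapp k (amap (D M) f phi)) by0.
rewrite bidualE => e; rewrite [LHS]e /lapp /= /nappL /=.
by rewrite amap_el0 raddf0.
Qed.

Lemma bidual_surj M : fp (M : ModC C) -> nsurjective (bidual E M).
Proof.
move=> hM Y xi; pose t := untranspose (yon xi).
have [s st] := dual_full t (fp_repr Y) hM.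
exists (s Y (rid Y)); apply: lapp_ext => phi; rewrite bidualE.
have := congr1 (fun k : nattrans (D M) (D (repr_functor Y)) => lapp (k Y phi) (rid Y)) st.
rewrite /t untransposeE yon_id => <-; by [].
Qed.

(** Such an [N] is the dual of some [M], and [M] is reflexive. *)
Lemma codual_fp N : fp (N : ModC (rop C)) -> fp (codual_functor E N : ModC C).
Proof.
move=> /dual_ess[M hM [f [g [gf fg]]]].
apply: (fp_iso _ hM).
have gfE A x : g A (f A x) = x := nt_app gf x.
have fgE A x : f A (g A x) = x := nt_app fg x.
have [||b bE] := nat_lift (m := bidual E M) (g := codual_nattrans E f).
- exact: bidual_inj.
- by move=> A x; apply: bidual_surj.
exists (ntcomp (codual_nattrans E g) (bidual E M)), b; split; apply: nattrans_ext => A x.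
  apply: bidual_inj => //; apply: etrans (bE _ _) _; apply: lapp_ext => phi.
  by rewrite /lapp /= /nappL gfE.
apply: etrans (congr1 (codual_nattrans E g A) (bE A x)) _; apply: lapp_ext => n.
by rewrite /lapp /= /nappL fgE.
Qed.

Lemma corepr_fp Z : fp (corepr Z : ModC C).
Proof. exact/codual_fp/fp_repr. Qed.

(** The kernel of [f] is the codual of the cokernel of its dual. *)
Lemma kernel_cover X Y (f : nattrans X Y) : fp (X : ModC C) -> fp (Y : ModC C) ->
  exists Z (k : nattrans (repr_functor Z) X), exact_at k f.
Proof.
move=> hX hY.
have [K [p [hK surjp exp]]] :=
  cokernel_fp (dual_nattrans E f) dualizing_biproducts_op (dual_fp hY) (dual_fp hX).
have [_ [Z [_ [e [_ surje]]]]] := codual_fp hK.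
have [||k kE] := nat_lift (m := bidual E X) (g := ntcomp (codual_nattrans E p) e).
- exact: bidual_inj.
- by move=> A h; apply: bidual_surj.
exists Z, k => A x; split=> [fx|[h <-]].
  have [||phi phiE] := @linear_factor R (rval (D X) A) (rval K A) E
    (mklin (@napp_linear R (rop C) _ _ p A)) (bidual E X A x : {linear _ -> _}).
  - exact: surjp.
  - move=> psi /exp[eta <-].
    rewrite -[LHS]/(lapp (eta : {linear rval Y A -> E}) (f A x)) fx.
    exact: (raddf0 (eta : {linear rval Y A -> E})).
  have [h eh] := surje A phi; exists h; apply: bidual_inj => //; rewrite kE.
  apply: lapp_ext => psi; rewrite /= eh; exact: phiE.
apply: bidual_inj => //; rewrite napp0; apply: lapp_ext => psi; rewrite bidualE.
have := congr1 (fun t : codual_functor E (D X) A => lapp t (dual_nattrans E f A psi)) (kE A h).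
rewrite bidualE -[lapp (dual_nattrans _ _ _ _) _]/(lapp psi (f A (k A h))) => ->.
rewrite -[LHS]/(lapp (e A h) (p A (dual_nattrans E f A psi))).
have -> : p A (dual_nattrans E f A psi) = 0 by apply/exp; exists psi.
exact: (raddf0 (e A h : {linear rval K A -> E})).
Qed.

(** Covering the dual of the cokernel of [f] embeds that cokernel. *)
Lemma cokernel_hull X Y (f : nattrans X Y) : fp (X : ModC C) -> fp (Y : ModC C) ->
  exists Z (k : nattrans Y (corepr Z)), exact_at f k.
Proof.
move=> hX hY; have [W [p [hW surjp exp]]] := cokernel_fp f dualizing_biproducts hX hY.
have [_ [Z [_ [e [_ surje]]]]] := dual_fp hW.
exists Z, (ntcomp (transpose e) p) => A y; rewrite -exp.
rewrite -[ntcomp _ _ A y]/(transpose e A (p A y)); split=> [h|->]; last exact: napp0.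
apply: (bidual_inj hW); rewrite napp0; apply: lapp_ext => phi; rewrite bidualE.
have [g <-] := surje A phi.
have e0 : transpose e A (p A y) = (0 : linhom (@rval R (rop C) (@repr_functor R (rop C) Z) A) E).
  exact: h.
exact: (congr1 (fun t : linhom (@rval R (rop C) (@repr_functor R (rop C) Z) A) E => lapp t g) e0).
Qed.

Definition ker_functor X Y (f : nattrans X Y) : afunctor C :=
  sub_functor (mksub (ker_subclosed f)).

Lemma ker_fp X Y (f : nattrans X Y) : fp (X : ModC C) -> fp (Y : ModC C) ->
  fp (ker_functor f : ModC C).
Proof.
move=> hX hY; have [Z0 [k0 ex0]] := kernel_cover f hX hY.
have [Z1 [k1 ex1]] := kernel_cover k0 (fp_repr Z0) hX.
have im : forall A x, exists y, sub_incl (mksub (ker_subclosed f)) A y = k0 A x.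
  by move=> A x; apply/sub_incl_im/in_mksub/ex0; exists x.
have [q qE] := nat_lift (@sub_incl_inj _ _ _ _) im.
exists Z1, Z0, k1, q; split=> [A x|A y].
  rewrite -ex1 -qE; split=> [->|h]; first exact: napp0.
  by apply: sub_incl_inj; rewrite h napp0.
have /in_mksub/ex0[x hx] : sub_incl _ A y \in mksub (ker_subclosed f) A.
  by apply/sub_incl_im; exists y.
by exists x; apply: sub_incl_inj; rewrite qE.
Qed.

Definition im_functor X Y (f : nattrans X Y) : afunctor C :=
  sub_functor (mksub (im_subclosed f)).

Lemma im_fp Z X (f : nattrans (repr_functor Z) X) : fp (X : ModC C) ->
  fp (im_functor f : ModC C).
Proof.
move=> hX; have [Z1 [k ex]] := kernel_cover f (fp_repr Z) hX.
have im : forall A x, exists y, sub_incl (mksub (im_subclosed f)) A y = f A x.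
  by move=> A x; apply/sub_incl_im/in_mksub; exists x.
have [q qE] := nat_lift (@sub_incl_inj _ _ _ _) im.
exists Z1, Z, k, q; split=> [A x|A y].
  rewrite -ex -qE; split=> [->|h]; first exact: napp0.
  by apply: sub_incl_inj; rewrite h napp0.
have /in_mksub[x hx] : sub_incl _ A y \in mksub (im_subclosed f) A.
  by apply/sub_incl_im; exists y.
by exists x; apply: sub_incl_inj; rewrite qE.
Qed.

Lemma corepr_injective Z : injective_in (@everything (ModR R)) E ->
  injective_in (@fp R C) (corepr Z).
Proof.
move=> injE; split=> [|A B _ _ m f /nmono_injective inj]; first exact: corepr_fp.
have [|h hE] := corepr_extend injE (f := m) (g := f).
  by move=> x mx; rewrite (inj _ x 0) ?napp0 // mx napp0.
by exists h; apply: nattrans_ext => Y x; exact: hE.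
Qed.

Lemma fp_value_fg X A : fp (X : ModC C) -> fg (rval X A : ModR R).
Proof.
move=> [_ [Z [_ [e [_ surj]]]]].
have lin : linear (fun f : rhom Z A => e A f : rval X A).
  move=> r f g; rewrite nappD; congr (_ + _).
  by rewrite rvalZ -nappE /= rcompZl rcomp1l.
have [[_ _ _ fgh] _] := hC.
exact: (fg_quotient (f := mklin lin) (surj A) (fgh Z A)).
Qed.
End Dualizing.

(** * Summands of powers *)

Section Retracts.
Variables (R : comPzRingType) (C : rcategory R).
Implicit Types (M X W : afunctor C).

(** A dual basis for [X] over [M]; it avoids the complement in [in_add]. *)
Definition retract_of_power M X :=
  exists n (s : 'I_n -> nattrans M X) (r : 'I_n -> nattrans X M),
    forall Y x, \sum_i s i Y (r i Y x) = x.

Section Power.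
Variables (M : afunctor C) (n : nat).

Definition pow_in (i : 'I_n) : nattrans M (pow_functor M n).
Proof.
exists (fun Y x => [ffun k => if k == i then x else 0] : {ffun 'I_n -> M Y}).
- by move=> Y x y; apply/ffunP=> k; rewrite !ffunE; case: eqP; rewrite ?addr0.
- by move=> Y Z f x; apply/ffunP=> k; rewrite !ffunE; case: eqP; rewrite ?amap_el0.
Defined.

Definition pow_pr (i : 'I_n) : nattrans (pow_functor M n) M.
Proof.
exists (fun Y (x : {ffun 'I_n -> M Y}) => x i).
- by move=> Y x y; rewrite ffunE.
- by move=> Y Z f x; rewrite /= ffunE.
Defined.

Definition pow_pair X (r : 'I_n -> nattrans X M) : nattrans X (pow_functor M n).
Proof.
exists (fun Y x => [ffun k => r k Y x] : {ffun 'I_n -> M Y}).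
- by move=> Y x y; apply/ffunP=> k; rewrite !ffunE nappD.
- by move=> Y Z f x; apply/ffunP=> k; rewrite !ffunE nappE.
Defined.

Lemma pow_sum Y (x : pow_functor M n Y) : x = \sum_i pow_in i Y (x i).
Proof.
apply/ffunP => k.
have sumE (F : 'I_n -> {ffun 'I_n -> M Y}) : (\sum_i F i) k = \sum_i F i k.
  by elim/big_ind2: _ => [|x1 x2 y1 y2 <- <-|//]; rewrite ffunE.
rewrite [RHS]sumE (bigD1 k) //= big1 => [|j jk]; first by rewrite ffunE eqxx addr0.
by rewrite ffunE eq_sym (negbTE jk).
Qed.
End Power.

Definition sum_inl X W : nattrans X (sum_functor X W).
Proof.
exists (fun Y x => (x, 0) : X Y * W Y) => [Y x y|Y Z f x]; last by rewrite /= amap_el0.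
by congr pair; rewrite addr0.
Defined.

Definition sum_fst X W : nattrans (sum_functor X W) X.
Proof. by exists (fun Y (x : X Y * W Y) => x.1). Defined.

(** From a dual basis [s], [r], the complement of [X] in the power is the kernel of the
    combined map [t] from the power to [X], which [u] splits. *)
Lemma in_addP M X : in_add (M : ModC C) X <-> retract_of_power M X.
Proof.
split=> [[n [W [f [g [gf _]]]]]|[n [s [r sr]]]].
  exists n, (fun i => ntcomp (sum_fst X W) (ntcomp g (pow_in M i))).
  exists (fun i => ntcomp (pow_pr M i) (ntcomp f (sum_inl X W))) => Y x.
  have gfE y : g Y (f Y y) = y := nt_app gf y.
  pose y := f Y (sum_inl X W Y x).
  transitivity (sum_fst X W Y (g Y (\sum_i pow_in M i Y ((y : {ffun _ -> _}) i)))).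
    by rewrite !napp_sum.
  by rewrite -pow_sum gfE.
pose sig Y (x : pow_functor M n Y) := \sum_i s i Y ((x : {ffun _ -> _}) i).
pose t : nattrans (pow_functor M n) X := \sum_i ntcomp (s i) (pow_pr M i).
pose u := pow_pair r.
have tu Y x : t Y (u Y x) = x.
  rewrite /t nt_sumE -[RHS]sr; apply: eq_bigr => i _.
  by rewrite /= ffunE.
pose T := mksub (ker_subclosed t); exists n, (sub_functor T).
have im Y y : exists k, sub_incl T Y k = (y - u Y (t Y y)).
  by apply/sub_incl_im/in_mksub; rewrite nappB tu subrr.
have prD : forall Y, {morph (fun y : pow_functor M n Y => y - u Y (t Y y)) : a b / a + b}.
  by move=> Y a b; rewrite (nappD t) (nappD u) opprD addrACA.
have prM : forall Y Z (f : rhom Y Z) y,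
    amap _ f y - u Z (t Z (amap (pow_functor M n) f y)) = amap _ f (y - u Y (t Y y)).
  by move=> Y Z f y; rewrite (nappE t) (nappE u) amap_elB.
have [q qE] := nat_lift (g := NatTrans prD prM) (@sub_incl_inj _ _ _ T) im.
have fD : forall Y, {morph (fun x : X Y * sub_functor T Y => u Y x.1 + sub_incl T Y x.2) : a b / a + b}.
  by move=> Y a b; rewrite (nappD u) (nappD (sub_incl T)) addrACA.
have fM : forall Y Z (f : rhom Y Z) (x : X Y * sub_functor T Y),
    u Z (amap X f x.1) + sub_incl T Z (amap (sub_functor T) f x.2) =
    amap _ f (u Y x.1 + sub_incl T Y x.2).
  by move=> Y Z f x; rewrite (nappE u) (nappE (sub_incl T)) amap_elD.
have gD : forall Y, {morph (fun y => (t Y y, q Y y) : X Y * sub_functor T Y) : a b / a + b}.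
  by move=> Y a b; rewrite (nappD t) (nappD q).
have gM : forall Y Z (f : rhom Y Z) y,
    (t Z (amap _ f y), q Z (amap _ f y)) = (amap X f (t Y y), amap (sub_functor T) f (q Y y)).
  by move=> Y Z f y; rewrite (nappE t) (nappE q).
have tT Y (k : sub_functor T Y) : t Y (sub_incl T Y k) = 0.
  by apply/(in_mksub (ker_subclosed t))/sub_incl_im; exists k.
exists (@NatTrans _ _ (sum_functor X (sub_functor T)) _ _ fD fM).
exists (@NatTrans _ _ _ (sum_functor X (sub_functor T)) _ gD gM).
split; apply: nattrans_ext => Y.
  move=> [x k]; congr pair; first by rewrite [LHS]nappD tu tT addr0.
  apply: (@sub_incl_inj _ _ _ T); apply: etrans (qE _ _) _ => /=.
  by rewrite nappD tu tT addr0 addrC addKr.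
move=> y; apply: etrans (congr1 (+%R (u Y (t Y y))) (qE _ _)) _.
by rewrite /= addrC subrK.
Qed.

(** Dual bases compose. *)
Lemma retract_of_power_trans L M X :
  retract_of_power L M -> retract_of_power M X -> retract_of_power L X.
Proof.
move=> [m [s [r sr]]] [n [s' [r' sr']]].
pose T := ('I_n * 'I_m)%type.
exists #|{: T}|, (fun k => ntcomp (s' (enum_val k).1) (s (enum_val k).2)).
exists (fun k => ntcomp (r (enum_val k).2) (r' (enum_val k).1)) => Y x.
transitivity (\sum_(p : T) s' p.1 Y (s p.2 Y (r p.2 Y (r' p.1 Y x)))).
  by rewrite (reindex _ (onW_bij _ (@enum_val_bij T))) /=.
rewrite -(pair_bigA _ (fun i j => s' i Y (s j Y (r j Y (r' i Y x))))) /=.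
by rewrite -[RHS]sr'; apply: eq_bigr => i _; rewrite -napp_sum sr.
Qed.
End Retracts.

Lemma direct_power_ex (R : comPzRingType) (C : rcategory R) (X0 : C) n :
    has_zero_object C -> has_biproducts C ->
  exists (Z : C) (i : 'I_n -> rhom X0 Z) (p : 'I_n -> rhom Z X0),
    (forall j k, p j ⊚ i k = if j == k then rid X0 else 0) /\ \sum_j i j ⊚ p j = rid Z.
Proof.
move=> [O O0] bip; elim: n => [|n [Z [i [p [pi ip]]]]].
  by exists O, (fun=> 0), (fun=> 0); split=> [[]|]; rewrite ?big_ord0.
have [Z' [a [b [c [d [ca db cb da e]]]]]] := bip X0 Z.
exists Z', (fun k => if unlift ord0 k is Some k' then b ⊚ i k' else a).
exists (fun k => if unlift ord0 k is Some k' then p k' ⊚ d else c); split.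
  move=> j k; case: (unliftP ord0 j) (unliftP ord0 k) => [j'|] -> [k'|] ->.
  - rewrite (inj_eq lift_inj) -pi -rcompA (rcompA d) db rcomp1l //.
  - by rewrite -rcompA da rcomp0r.
  - by rewrite rcompA cb rcomp0l.
  - by rewrite eqxx.
rewrite big_ord_recl unlift_none -e; congr (_ + _).
rewrite -[in RHS](rcomp1l d) -ip rcomp_suml rcomp_sumr; apply: eq_bigr => k _.
by rewrite liftK !rcompA.
Qed.

(** * Modules over the endomorphism ring of a representable functor *)

Section Evaluation.
Variables (R : comPzRingType) (E : lmodType R) (C : rcategory R) (C0 : C).
Local Notation P := (repr_functor C0).
Local Notation A := (Rop P).
Local Notation I := (corepr E C0).
Local Notation H X := (homP_mod P X : lmodType A).

(** The ring [A] is the endomorphism ring of [C0]; the two reversals of the order, in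
    the Yoneda embedding and in the opposite ring, cancel ([actM]). *)
Definition act (a : rhom C0 C0) : A := yon (a : P C0).

Lemma actE (c : A) : c = act ((c : nattrans P P) C0 (rid C0)).
Proof. exact: yonE. Qed.

Lemma actM a b : act a * act b = act (a ⊚ b).
Proof. exact: ntcomp_yon. Qed.

Lemma actD a b : act (a + b) = act a + act b.
Proof. by apply: nattrans_ext => Y f /=; rewrite rcompDr. Qed.

Definition rscal (r : R) : A := act (r *: rid C0).

Lemma rscal_act r a : rscal r * act a = act (r *: a).
Proof. by rewrite actM rcompZl rcomp1l. Qed.

(** Every module over [Rop P] is one over [R], by way of the action of [R] on [C0]. *)
Section Restriction.
Variable M : lmodType A.
Definition res : Type := M.
HB.instance Definition _ := GRing.Zmodule.on res.
Definition res_scale (r : R) (m : res) : res := rscal r *: (m : M).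
Lemma res_scaleA a b v : res_scale a (res_scale b v) = res_scale (a * b) v.
Proof. by rewrite /res_scale scalerA rscal_act scalerA. Qed.
Lemma res_scale1 : left_id 1 res_scale.
Proof.
move=> x; rewrite /res_scale /rscal scale1r -[RHS](@scale1r A M).
by congr (_ *: _); rewrite [RHS]actE.
Qed.
Lemma res_scaleDr : right_distributive res_scale +%R.
Proof. by move=> a x y; rewrite /res_scale scalerDr. Qed.
Lemma res_scaleDl v : {morph res_scale^~ v : a b / a + b}.
Proof. by move=> a b; rewrite /res_scale /rscal scalerDl actD scalerDl. Qed.
HB.instance Definition _ := GRing.Zmodule_isLmodule.Build R res
  res_scaleA res_scale1 res_scaleDr res_scaleDl.
End Restriction.

Lemma resZ (M : lmodType A) r (m : res M) : r *: m = rscal r *: (m : M).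
Proof. by []. Qed.

Lemma res_linear (U V : lmodType A) (f : {linear U -> V}) :
  linear (f : res U -> res V).
Proof. by move=> r x y; rewrite !resZ linearP. Qed.

Lemma res_submodule (M : lmodType A) (U : M -> Prop) :
  submodule U -> submodule (U : res M -> Prop).
Proof. by move=> [h0 h]; split=> // r x y; apply: h. Qed.

Lemma fg_of_finite (B : pzRingType) (V : lmodType B) (T : finType) (v : T -> V) :
  (forall x, exists c : T -> B, x = \sum_t c t *: v t) -> fg (V : ModR B).
Proof.
move=> gen; exists #|T|, (fun k => v (enum_val k)) => x; have [c ->] := gen x.
exists (fun k => c (enum_val k)).
by rewrite (reindex _ (onW_bij _ (@enum_val_bij T))).
Qed.

(** The products of the generators of [M] and of the endomorphisms of [C0]. *)
Lemma res_fg (M : lmodType A) : fg (rhom C0 C0 : ModR R) -> fg (M : ModR A) ->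
  fg (res M : ModR R).
Proof.
move=> [k [a gena]] [n [v genv]].
apply: (@fg_of_finite _ _ ('I_n * 'I_k)%type (fun p => act (a p.2) *: v p.1 : res M)) => m.
have [c ->] := genv m.
have [d dE] := choice (fun i => gena ((c i : nattrans P P) C0 (rid C0))).
exists (fun p => d p.1 p.2).
rewrite -(pair_bigA _ (fun i j => d i j *: (act (a j) *: v i : res M))) /=.
apply: eq_bigr => i _; rewrite [c i]actE dE.
have actS (F : 'I_k -> rhom C0 C0) : act (\sum_j F j) = \sum_j act (F j).
  elim/big_ind2: _ => [|x1 x2 y1 y2 <- <-|//]; last by rewrite actD.
  by apply: nattrans_ext => Y f /=; rewrite rcomp0r.
rewrite actS scaler_suml; apply: eq_bigr => j _.
by rewrite resZ scalerA rscal_act.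
Qed.

Lemma fg_dcc_endo (M : lmodType A) : artinian R -> fg (rhom C0 C0 : ModR R) ->
  fg (M : ModR A) -> dcc M.
Proof.
move=> hR hfg hM; apply: (@dcc_bij R A (res M) M id); last exact/fg_dcc/res_fg.
  move=> U hU; have [h0 h] := res_submodule hU; split=> [|r _ _ [x hx <-] [y hy <-]].
    by exists 0.
  by exists (r *: (x : res M) + y) => //; apply: h.
by [].
Qed.

Lemma endo_fg : fg ((A^o : lmodType A) : ModR A).
Proof.
exists 1%N, (fun=> 1) => m; exists (fun=> m).
by rewrite big_ord1 /GRing.scale /= mulr1.
Qed.

Section HomValue.
Variable X : afunctor C.

Lemma hom_ext (s t : H X) : (s : nattrans P X) C0 (rid C0) = (t : nattrans P X) C0 (rid C0) ->
  s = t.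
Proof. by move=> e; rewrite [s]yonE e -yonE. Qed.

Lemma act_yon a (x : X C0) : act a *: (yon x : H X) = yon (amap X a x).
Proof. exact: ntcomp_yon. Qed.

Lemma act_app a (t : H X) :
  (act a *: t : nattrans P X) C0 (rid C0) = amap X a ((t : nattrans P X) C0 (rid C0)).
Proof. by rewrite {1}[t]yonE act_yon yon_id. Qed.

Lemma yonD (x y : X C0) : (yon (x + y) : H X) = (yon x : H X) + (yon y : H X).
Proof. by apply: hom_ext; rewrite !yon_id /= !amap1. Qed.

Lemma res_yon r (x : rval X C0) : (yon (r *: x : X C0) : res (H X)) = r *: (yon x : res (H X)).
Proof. by rewrite resZ act_yon. Qed.

Lemma HomP_fg : fg (rval X C0 : ModR R) -> fg (H X : ModR A).
Proof.
move=> [n [v gen]]; exists n, (fun i => yon (v i : X C0) : H X) => t.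
have [c cE] := gen ((t : nattrans P X) C0 (rid C0)).
exists (fun i => rscal (c i)); rewrite [t]yonE cE.
have yonS (F : 'I_n -> X C0) : (yon (\sum_i F i) : H X) = \sum_i (yon (F i) : H X).
  elim/big_ind2: _ => [|x1 x2 y1 y2 <- <-|//]; last by rewrite yonD.
  by apply: hom_ext; rewrite /= amap_el0.
rewrite [LHS]yonS; apply: eq_bigr => i _.
exact: (@res_yon (c i) (v i)).
Qed.

End HomValue.

(** [HomP P (corepr C0)] is coinduced from [E]: maps into it are the [R]-linear
    maps into [E], which is what [functional] and [coind] express. *)
Definition functional (t : H I) : E :=
  lapp (U := @rval R (rop C) (@repr_functor R (rop C) C0) C0) ((t : nattrans P I) C0 (rid C0))
    (rid C0).

Lemma functional_act a (t : H I) : functional (act a *: t) =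
  lapp (U := @rval R (rop C) (@repr_functor R (rop C) C0) C0) ((t : nattrans P I) C0 (rid C0)) a.
Proof. by rewrite /functional act_app corepr_amap rcomp1l. Qed.

Lemma functional_ext (s t : H I) :
  (forall a, functional (act a *: s) = functional (act a *: t)) -> s = t.
Proof.
by move=> h; apply/hom_ext/lapp_ext => a; have := h a; rewrite !functional_act.
Qed.

Lemma functional_linear (M : lmodType A) (f : {linear M -> H I}) :
  linear (fun m : res M => functional (f m)).
Proof.
move=> r m n; rewrite resZ linearP.
rewrite -[LHS]/(functional (rscal r *: f m) + functional (f n)).
rewrite functional_act; congr (_ + _).
have lin := linearZ_LR (((f m : nattrans P I) C0 (rid C0)) :
  {linear @rval R (rop C) (@repr_functor R (rop C) C0) C0 -> E}) r (rid C0).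
apply: etrans lin; congr (lapp _ _).
by rewrite rvalZ /= rcomp1l.
Qed.

Section Coinduction.
Variables (M : lmodType A) (mu : {linear res M -> E}).

Lemma coind_functional_linear (m : M) :
  linear (fun a : @rval R (rop C) (@repr_functor R (rop C) C0) C0 => mu (act a *: m)).
Proof.
move=> r a b; rewrite -linearP resZ scalerA rscal_act.
by rewrite rvalZ /= rcompZr rcompr1 actD scalerDl.
Qed.

Definition coind_fun (m : M) : H I := yon (mklin (coind_functional_linear m) : I C0).

Lemma coind_funE m : functional (coind_fun m) = mu m.
Proof.
have e1 : act (rid C0) = 1 by rewrite [RHS]actE.
by rewrite -[coind_fun m]scale1r -e1 functional_act yon_id -[LHS]/(mu (act (rid C0) *: m)) e1 scale1r.
Qed.

Lemma coind_act a m : functional (act a *: coind_fun m) = mu (act a *: m).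
Proof. by rewrite functional_act yon_id. Qed.

Lemma coind_linear : linear coind_fun.
Proof.
move=> c m n; apply: functional_ext => a; rewrite coind_act !scalerDr.
rewrite [c]actE !scalerA actM.
set b := a ⊚ _.
transitivity (mu (act b *: m) + mu (act a *: n)); first exact: (raddfD mu).
by rewrite -!coind_act.
Qed.
Definition coind : {linear M -> H I} := mklin coind_linear.
Lemma coindE m : functional (coind m) = mu m.
Proof. exact: coind_funE. Qed.
End Coinduction.

Lemma coind_ext (M : lmodType A) (f g : {linear M -> H I}) :
  (forall m, functional (f m) = functional (g m)) -> f =1 g.
Proof. by move=> h m; apply: functional_ext => a; rewrite -!linearZ_LR h. Qed.

Lemma HomP_corepr_extend (U V : lmodType A) (f : {linear U -> V}) (g : {linear U -> H I}) :
  injective_in (@everything (ModR R)) E -> (forall x, f x = 0 -> g x = 0) ->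
  exists h : {linear V -> H I}, forall x, h (f x) = g x.
Proof.
move=> injE ker.
have [|mu muE] := injective_extend (f := mklin (res_linear f))
    (g := mklin (functional_linear g)) injE.
  by move=> x fx; rewrite /mklin /= /linmap ker.
exists (coind mu); apply: (coind_ext (f := lcomp (coind mu) f)) => x.
by rewrite /= [LHS]coindE; exact: muE.
Qed.

(** Nonzero elements are detected by functionals to [E], which coinduce linear maps. *)
Lemma HomP_corepr_separates (M : lmodType A) (m : M) :
  (forall (V : lmodType R) (x : V), (forall f : {linear V -> E}, f x = 0) -> x = 0) ->
  (forall f : {linear M -> H I}, f m = 0) -> m = 0.
Proof.
move=> cog h; apply: (cog (res M)) => mu.
by rewrite -(coindE mu) h.
Qed.

(** Both sides are functionals on the value of [X] at [C0]. *)
Lemma rho_corepr_surj X (phi : {linear H X -> H I}) :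
  exists f : nattrans X I, forall t : H X, phi t = ntcomp f t.
Proof.
have lin : linear (fun x : rval X C0 => functional (phi (yon (x : X C0)))).
  move=> r x y; rewrite -(functional_linear phi r (yon (x : X C0)) (yon (y : X C0))).
  by rewrite yonD res_yon.
exists (coyon (mklin lin)).
apply: (@coind_ext _ phi (@postcomp _ _ P X I (coyon (mklin lin)))) => t.
rewrite [in LHS](yonE t).
rewrite -[RHS]/(lapp (coyon (mklin lin) C0 ((t : nattrans P X) C0 (rid C0))) (rid C0)).
by rewrite coyonE amap1.
Qed.
End Evaluation.

(** * The top of a representable functor and its injective envelope *)

Section Top.
Variables (R : comPzRingType) (C : rcategory R) (C0 : C).
Local Notation P := (repr_functor C0).
Local Notation A := (Rop P).
Implicit Types (S : subfunctor P) (L : (A^o : lmodType A) -> Prop).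

(** The identity of [C0] generates [P]. *)
Lemma sub_proper_id (S : subfunctor P) : sub_proper S <-> (rid C0 : P C0) \notin S C0.
Proof.
split=> [[Y [x]]|h]; last by exists C0, (rid C0).
by apply: contra => /(smap (x : rhom C0 Y)); rewrite /= rcompr1.
Qed.

(** The largest subfunctor of [P] with a given value at [C0]. *)
Definition saturation (L : P C0 -> Prop) Y (x : P Y) :=
  forall g : rhom Y C0, L (g ⊚ (x : rhom C0 Y)).

(** [left_ideal_of] and [sub_of_left_ideal] match the maximal subfunctors of [P] with the
    maximal left ideals of [A]. *)
Definition left_ideal_of (S : subfunctor P) (c : A) : Prop :=
  (c : nattrans P P) C0 (rid C0) \in S C0.

Lemma left_ideal_of_act S a : left_ideal_of S (act (a : rhom C0 C0)) <-> (a : P C0) \in S C0.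
Proof. by rewrite /left_ideal_of yon_id. Qed.

Lemma left_ideal_of_submodule S : submodule (left_ideal_of S : (A^o : lmodType A) -> Prop).
Proof.
split=> [|c x y hx hy]; first exact: rpred0.
apply: (@rpredD _ (S C0)) => //.
have -> : (c *: (x : A^o) : A) = act ((c : nattrans P P) C0 (rid C0) ⊚
    ((x : nattrans P P) C0 (rid C0) : rhom C0 C0)).
  by rewrite [c in LHS]actE [x in LHS]actE -actM.
by apply/left_ideal_of_act; exact: smap.
Qed.

Lemma saturation_subclosed (L : (A^o : lmodType A) -> Prop) : submodule L ->
  subclosed (saturation (fun a => L (act a))).
Proof.
move=> hL; split=> [Y g|Y x y hx hy g|Y Z f x hx g].
- rewrite rcomp0r; have -> : act (0 : rhom C0 C0) = 0.
    by apply: nattrans_ext => Y' f /=; rewrite rcomp0r.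
  exact: submodule0 hL.
- have -> : act (g ⊚ ((x - y : P Y) : rhom C0 Y)) = act (g ⊚ x) - act (g ⊚ y).
    apply/eqP; rewrite eq_sym subr_eq -actD; apply/eqP; congr act.
    by rewrite -rcompDr subrK.
  by apply: (submoduleB hL); [exact: hx | exact: hy].
- by rewrite /= rcompA; apply: hx.
Qed.

Definition sub_of_left_ideal (L : (A^o : lmodType A) -> Prop) (hL : submodule L) : subfunctor P :=
  mksub (saturation_subclosed hL).

Lemma in_sub_of_left_ideal L (hL : submodule L) (a : rhom C0 C0) :
  (a : P C0) \in sub_of_left_ideal hL C0 <-> L (act a).
Proof.
rewrite in_mksub; split=> [/(_ (rid C0))|h g]; first by rewrite rcomp1l.
by rewrite -actM; exact: (submoduleZ hL (act g) h).
Qed.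

Lemma sub_of_left_ideal_proper L (hL : submodule L) :
  sub_proper (sub_of_left_ideal hL) <-> ~ L 1.
Proof.
have -> : (1 : A) = act (rid C0) by rewrite [LHS]actE.
rewrite sub_proper_id -(in_sub_of_left_ideal hL); split=> [/negP|/negP] //.
Qed.

Lemma sub_le_saturation (S : subfunctor P) L (hL : submodule L) :
  (forall c, left_ideal_of S c -> L c) -> sub_le S (sub_of_left_ideal hL).
Proof.
move=> SL Y x xS; apply/in_mksub => g; apply/SL/left_ideal_of_act.
exact: (smap (g : rhom Y C0) xS).
Qed.

Lemma maximal_sub_left_ideal S : maximal_sub S -> maximal_left_ideal (left_ideal_of S).
Proof.
move=> [pS mS]; have id1 : (1 : A) = act (rid C0) by rewrite [LHS]actE.
split; first exact: left_ideal_of_submodule.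
  by rewrite id1 left_ideal_of_act; apply/negP/sub_proper_id.
move=> L hL sub /(sub_of_left_ideal_proper hL) pL c Lc.
rewrite [c]actE; apply/left_ideal_of_act; apply: (mS _ _ pL); first exact: sub_le_saturation.
by apply/in_sub_of_left_ideal; rewrite -actE.
Qed.

Lemma maximal_left_ideal_sub L (mL : maximal_left_ideal L) (hL : submodule L) :
  maximal_sub (sub_of_left_ideal hL).
Proof.
have [_ nL1 mxL] := mL; split; first exact/sub_of_left_ideal_proper.
move=> T sub /sub_proper_id pT; apply: sub_le_saturation.
apply: mxL; first exact: left_ideal_of_submodule.
  move=> c Lc; rewrite [c]actE; apply/left_ideal_of_act/sub/in_sub_of_left_ideal.
  by rewrite -actE.
have -> : (1 : A) = act (rid C0) by rewrite [LHS]actE.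
by rewrite left_ideal_of_act; apply/negP.
Qed.

(** The radical of [P] at [C0] is the Jacobson radical of [A]. *)
Lemma radf_at (a : rhom C0 C0) :
  (a : P C0) \in radf P C0 <-> forall L, maximal_left_ideal L -> L (act a).
Proof.
split=> [/asboolP h L mL|h].
  have [hL _ _] := mL; apply/(in_sub_of_left_ideal hL)/h.
  exact: maximal_left_ideal_sub.
apply/asboolP => S mS; apply/left_ideal_of_act; apply: h.
exact: maximal_sub_left_ideal.
Qed.

(** The radical is saturated, hence subfunctors of the top that vanish at [C0] are zero. *)
Lemma radf_saturated Y (x : P Y) :
  (forall g : rhom Y C0, (g ⊚ (x : rhom C0 Y) : P C0) \in radf P C0) -> x \in radf P Y.
Proof.
move=> h; apply/asboolP => S mS; have [hS nS1 _] := maximal_sub_left_ideal mS.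
have [_ mxS] := mS; apply: (mxS (sub_of_left_ideal hS)).
- exact: sub_le_saturation.
- exact/sub_of_left_ideal_proper.
- apply/in_mksub => g; apply/left_ideal_of_act.
  by have /asboolP/(_ S mS) := h g.
Qed.

Lemma top_eq0 Y (x : quo_functor (radf P) Y) :
  (forall g : rhom Y C0, amap (quo_functor (radf P)) g x = 0) -> x = 0.
Proof.
have [y <-] := quo_proj_surj x => h; apply/quo_proj_eq0; apply: radf_saturated => g.
by apply/quo_proj_eq0; have := h g; rewrite -nappE.
Qed.
End Top.

Section Envelope.
Variables (R : comPzRingType) (E : lmodType R) (C : rcategory R) (C0 : C).
Hypotheses (hR : artinian R) (hC : dualizing C E).
Hypothesis injE : injective_in (@everything (ModR R)) E.
Hypothesis cogE : forall (V : lmodType R) (x : V),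
  (forall f : {linear V -> E}, f x = 0) -> x = 0.
Local Notation P := (repr_functor C0).
Local Notation A := (Rop P).
Local Notation I := (corepr E C0).
Local Notation H X := (homP_mod P X : lmodType A).

Lemma hom_fg (X Y : C) : fg (rhom X Y : ModR R).
Proof. by have [[_ _ _ h] _] := hC; exact: h. Qed.

Definition corepr_map (Z Z' : C) (g : rhom Z Z') : nattrans (corepr E Z') (corepr E Z) :=
  codual_nattrans E (@yon R (rop C) (@repr_functor R (rop C) Z') Z g).

Lemma corepr_mapE (Z Z' : C) (g : rhom Z Z') Y (phi : corepr E Z' Y) (h : rhom Y Z) :
  lapp (corepr_map g Y phi) h = lapp phi (g ⊚ h).
Proof. by []. Qed.

Section Powers.
Variables (n : nat) (Z : C) (i : 'I_n -> rhom C0 Z) (p : 'I_n -> rhom Z C0).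
Hypotheses (pi : forall j k, p j ⊚ i k = if j == k then rid C0 else 0)
  (ip : \sum_j i j ⊚ p j = rid Z).

Lemma repr_power : retract_of_power P (repr_functor Z).
Proof.
exists n, (fun j => yon (p j : repr_functor Z C0)), (fun j => yon (i j : repr_functor C0 Z)).
move=> Y f /=; rewrite -[RHS]rcompr1 -ip rcomp_sumr.
by apply: eq_bigr => j _; rewrite rcompA.
Qed.

Lemma lapp_sum (U V : lmodType R) m (f : 'I_m -> linhom U V) x :
  lapp (\sum_j f j) x = \sum_j lapp (f j) x.
Proof. by elim/big_ind2: _ => [|x1 x2 y1 y2 <- <-|]. Qed.

Lemma corepr_power : retract_of_power I (corepr E Z).
Proof.
exists n, (fun j => corepr_map (p j)), (fun j => corepr_map (i j)) => Y phi.
apply: lapp_ext => h; rewrite lapp_sum.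
have hE : h = \sum_j (i j ⊚ p j) ⊚ (h : rhom Y Z) by rewrite -rcomp_suml ip rcomp1l.
rewrite [in RHS]hE [RHS](raddf_sum (phi : {linear _ -> _})).
by apply: eq_bigr => j _; rewrite !corepr_mapE rcompA.
Qed.

Lemma corepr_map_orthogonal j k Y (phi : I Y) :
  corepr_map (i j) Y (corepr_map (p k) Y phi) = if j == k then phi else 0.
Proof.
apply: lapp_ext => h; rewrite !corepr_mapE rcompA pi eq_sym; case: eqP => // _.
  by rewrite rcomp1l.
by rewrite rcomp0l; exact: (raddf0 (phi : {linear _ -> _})).
Qed.
End Powers.

Variables (J : afunctor C) (iota : nattrans (quo_functor (radf P)) J).
Hypothesis hJ : @injective_envelope_in (ModC C) (@fp R C) (quo_functor (radf P)) J iota.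

Lemma iota_inj : ninjective iota.
Proof. by have [/nmono_injective h _ _] := hJ. Qed.

Lemma J_injective : injective_in (@fp R C) J. Proof. by have [_ h _] := hJ. Qed.

(** If [x] is nonzero, then by [top_separation] some multiple of the top of the
    subfunctor generated by [x] maps nontrivially to the top of [P], which lies in [J]. *)
Lemma envelope_separates (X : afunctor C) (x : X C0) : fp (X : ModC C) ->
  (forall h : nattrans X J, h C0 x = 0) -> x = 0.
Proof.
move=> hX all0; apply: contrapT => nx0.
(* [K] is the annihilator of [x]. *)
pose K (c : A) := amap X ((c : nattrans P P) C0 (rid C0)) x = 0.
have KE a : K (act a) <-> amap X a x = 0 by rewrite /K yon_id.
have hK : submodule (K : (A^o : lmodType A) -> Prop).
  split=> [|c y z hy hz].
    exact: amap0.
  have e : ((c *: (y : A^o) + (z : A^o) : A) : nattrans P P) C0 (rid C0) =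
    (((c *: (y : A^o) : A) : nattrans P P) C0 (rid C0) : rhom C0 C0) +
      (z : nattrans P P) C0 (rid C0) by [].
  rewrite /K e amapD [X in _ + X]hz addr0 -[_ = _]/(K (c *: (y : A^o))).
  rewrite [c]actE [y]actE -[K _]/(K (act _ * act _)) actM KE amapM [amap X _ x]hy.
  exact: amap_el0.
have nK1 : ~ K 1 by rewrite /K amap1.
have dA : dcc (A^o : lmodType A).
  by apply: (fg_dcc_endo hR (hom_fg _ _)); exact: endo_fg.
have [t [[L mL nLt] Kt]] := top_separation dA hK nK1.
pose t0 : P C0 := (t : nattrans P P) C0 (rid C0).
(* The image of [f] is the subfunctor generated by [x]; right multiplication by [t]
   maps it to the top of [P]. *)
pose f : nattrans P X := yon x.
pose T := mksub (im_subclosed f).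
have im B y : exists z, sub_incl T B z = f B y by apply/sub_incl_im/in_mksub; exists y.
have [q qE] := nat_lift (@sub_incl_inj _ _ _ T) im.
have surjq : nsurjective q.
  move=> B y; have /in_mksub[z hz] : sub_incl T B y \in T B by apply/sub_incl_im; exists y.
  by exists z; apply: sub_incl_inj; rewrite qE.
have [g' g'E] : exists g' : nattrans (sub_functor T) (quo_functor (radf P)),
    forall B y, g' B (q B y) = quo_proj (radf P) B (yon t0 B y).
  apply: (nat_factor (g := ntcomp (quo_proj (radf P)) (yon t0)) surjq) => B y qy.
  apply/quo_proj_eq0/radf_saturated => g; apply/radf_at => L' mL'.
  have fy : f B y = 0 by rewrite -qE qy napp0.
  rewrite /= rcompA -actM -[act t0]actE; apply: Kt => //; apply/KE.
  by rewrite amapM [amap X y x]fy amap_el0.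
have [_ /(_ (sub_functor T) X (im_fp hC f hX) hX (sub_incl T) (ntcomp iota g'))] := J_injective.
case=> [|h hE]; first exact/nmono_injective/sub_incl_inj.
have : h C0 (sub_incl T C0 (q C0 (rid C0))) = iota C0 (g' C0 (q C0 (rid C0))) :=
  nt_app hE (q C0 (rid C0)).
rewrite qE g'E /f !yon_id all0 => /esym.
rewrite -(napp0 iota C0) => /iota_inj /quo_proj_eq0 /radf_at /(_ _ mL).
by rewrite /t0 -actE.
Qed.

(** Finitely many maps to [J] are jointly injective on [I]; the identity of [I] extends
    along them. *)
Lemma corepr_retract_envelope : retract_of_power J I.
Proof.
have dI : dcc (rval I C0) := fg_dcc hR (fp_value_fg hC C0 (corepr_fp hC C0)).
have [||n [h sep]] := dcc_separation (T := nattrans I J)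
    (k := fun h (x : rval I C0) => h C0 x = 0) dI.
- by move=> h; exact: (ker_submodule (mklin (@napp_linear R C _ _ h C0))).
- by move=> x; apply: envelope_separates; apply: corepr_fp.
have [|r rE] := corepr_extend injE (f := pow_pair h) (g := ntid I).
  by move=> x /ffunP hx; apply: sep => k; have := hx k; rewrite !ffunE.
exists n, (fun k => ntcomp r (pow_in J k)), h => Y x.
rewrite -[RHS]/(ntid I Y x) -rE -napp_sum; congr (r Y _).
by rewrite [RHS]pow_sum; apply: eq_bigr => k _; rewrite /= ffunE.
Qed.

(** The functionals that separate the top at [C0] give maps from the top to [I], which
    extend to [J]; together they are injective on the top, hence on its envelope [J],
    and they split because [J] is injective. *)
Lemma envelope_retract_corepr : retract_of_power I J.
Proof.
pose T : afunctor C := quo_functor (radf P).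
have fgT : fg (rval T C0 : ModR R).
  have lin := @napp_linear R C _ _ (quo_proj (radf P)) C0.
  apply: (fg_quotient (f := mklin lin)); first exact: quo_proj_surj.
  exact: (fp_value_fg hC C0 (fp_repr C0)).
have [||n [phi sep]] := dcc_separation (T := {linear rval T C0 -> E})
    (k := fun f x => f x = 0) (fg_dcc hR fgT).
- exact: ker_submodule.
- exact: cogE.
have ext j : exists g : nattrans J I, forall Y x, g Y (iota Y x) = coyon (phi j) Y x.
  apply: (corepr_extend injE) => x; rewrite -(napp0 iota C0) => /iota_inj ->.
  exact: napp0.
have [g gE] := choice ext.
have [[hZ hB _ _] _] := hC.
have [Z [i [p [pi ip]]]] := direct_power_ex C0 n hZ hB.
pose G : nattrans J (corepr E Z) := \sum_j ntcomp (corepr_map (p j)) (g j).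
have GE Y y : G Y y = \sum_j corepr_map (p j) Y (g j Y y) by rewrite /G nt_sumE.
have [_ _ env] := hJ.
have /(J_injective.2 _ _ J_injective.1 (corepr_fp hC Z) G (ntid J)) [r rG] :
    is_mono (G : @mor (ModC C) J (corepr E Z)).
  apply: env; first exact: corepr_fp.
  apply/nmono_injective/ninj0 => Y x Gx; apply: top_eq0 => f.
  have cx k : coyon (phi k) Y x = 0.
    have GkE : corepr_map (i k) Y (G Y (iota Y x)) = g k Y (iota Y x).
      rewrite GE napp_sum (bigD1 k) // big1 => [|j jk]; last first.
        by rewrite (corepr_map_orthogonal pi) eq_sym (negbTE jk).
      by apply: etrans (addr0 _) _; rewrite (corepr_map_orthogonal pi) eqxx.
    have Gx0 : G Y (iota Y x) = 0 := Gx.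
    by rewrite -gE -GkE Gx0 napp0.
  apply: (sep (amap T f x : rval T C0)) => k.
  by rewrite -coyonE cx.
exists n, (fun j => ntcomp r (corepr_map (p j))), g => Y x.
have rGx : r Y (G Y x) = x := nt_app rG x.
by rewrite -[RHS]rGx GE napp_sum.
Qed.
End Envelope.

(** * Full faithfulness of evaluation *)

Section Rho.
Variables (R : comPzRingType) (E : lmodType R) (C : rcategory R) (C0 : C).
Local Notation P := (repr_functor C0).
Local Notation A := (Rop P).
Local Notation I := (corepr E C0).
Local Notation H X := (homP_mod P X : lmodType A).
Implicit Types X Y Q : afunctor C.

Definition Hmap X Y (f : nattrans X Y) : {linear H X -> H Y} := @postcomp R C P X Y f.

Lemma at_of_hom X Y (f g : nattrans X Y) : (forall t : H X, ntcomp f t = ntcomp g t) ->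
  forall x : X C0, f C0 x = g C0 x.
Proof.
move=> fg x; have := nt_app (fg (yon x)) (rid C0).
by rewrite !ntcomp_yon !yon_id.
Qed.

(** Every element of [X] is a combination of images of elements at [C0]. *)
Lemma generated_eq X Y Q (e : nattrans Q X) (f g : nattrans X Y) :
  retract_of_power P Q -> nsurjective e ->
  (forall t : H X, ntcomp f t = ntcomp g t) -> f = g.
Proof.
move=> [n [s [r sr]]] surj fg; apply: nattrans_ext => B x; have [q <-] := surj B x.
rewrite -[q]sr !napp_sum; apply: eq_bigr => i _.
exact: (nt_app (fg (ntcomp e (s i))) (r i B q)).
Qed.

(** Transformations into [I] are determined at [C0]. *)
Lemma cogenerated_eq X Y Q (m : nattrans Y Q) (f g : nattrans X Y) :
  retract_of_power I Q -> ninjective m ->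
  (forall t : H X, ntcomp f t = ntcomp g t) -> f = g.
Proof.
move=> [n [s [r sr]]] inj /at_of_hom fg; apply: nattrans_ext => B x; apply: inj.
rewrite -[LHS]sr -[RHS]sr; apply: eq_bigr => i _; congr (s i B _).
have : ntcomp (r i) (ntcomp m f) = ntcomp (r i) (ntcomp m g).
  by apply: corepr_ext => y; rewrite /= fg.
by move/nt_app/(_ B x).
Qed.

Lemma cogenerated_eq0 Y Q (m : nattrans Y Q) B (y : Y B) :
  retract_of_power I Q -> ninjective m -> (forall g : rhom B C0, amap Y g y = 0) -> y = 0.
Proof.
move=> [n [s [r sr]]] inj h; apply: (inj B); rewrite napp0 -[LHS]sr big1 // => i _.
have -> : r i B (m B y) = 0; last exact: napp0.
by apply: corepr_eq0 => g; rewrite -!nappE h !napp0.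
Qed.

(** With a dual basis [s], [r] of [Q] over [P], a linear map is determined by, and can
    be prescribed through, its values on the elements [s i] of [H Q]. *)
Lemma rho_surj_gen Q Y (phi : {linear H Q -> H Y}) : retract_of_power P Q ->
  exists f : nattrans Q Y, forall t : H Q, phi t = ntcomp f t.
Proof.
move=> [n [s [r sr]]].
exists (\sum_i ntcomp (phi (s i : H Q) : nattrans P Y) (r i)) => t.
have tE : t = \sum_i (ntcomp (r i) t : A) *: (s i : H Q).
  by apply: nattrans_ext => B x; rewrite nt_sumE -[LHS]sr.
rewrite {1}tE linear_sum; apply: nattrans_ext => B x.
rewrite [LHS]nt_sumE /= nt_sumE; apply: eq_bigr => i _.
by rewrite linearZ_LR.
Qed.

(** The composites of [phi] with the [r i] come from transformations into [I], by
    [rho_corepr_surj]. *)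
Lemma rho_surj_cogen X Q (phi : {linear H X -> H Q}) : retract_of_power I Q ->
  exists f : nattrans X Q, forall t : H X, phi t = ntcomp f t.
Proof.
move=> [n [s [r sr]]].
have [f fE] := choice (fun i => rho_corepr_surj (lcomp (Hmap (r i)) phi)).
exists (\sum_i ntcomp (s i) (f i)) => t; apply: nattrans_ext => B x.
rewrite -[LHS]sr /= nt_sumE; apply: eq_bigr => i _.
exact: (congr1 (s i B) (nt_app (fE i t) x)).
Qed.

Lemma hom_cover X Q (e : nattrans Q X) (t : H X) : nsurjective e ->
  exists t' : H Q, t = ntcomp e t'.
Proof.
move=> surj; have [q qE] := surj C0 ((t : nattrans P X) C0 (rid C0)).
by exists (yon q); rewrite ntcomp_yon qE -yonE.
Qed.

(** A linear map on [H X] lifts to the cover [Q]; it descends to [X] when the lift kills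
    the kernel of the cover. *)
Lemma rho_surj_descend X Y Q (e : nattrans Q X) (phi : {linear H X -> H Y}) :
  retract_of_power P Q -> nsurjective e ->
  (forall f0 : nattrans Q Y, (forall t : H Q, phi (ntcomp e t : H X) = ntcomp f0 t) ->
     forall B z, e B z = 0 -> f0 B z = 0) ->
  exists f : nattrans X Y, forall t : H X, phi t = ntcomp f t.
Proof.
move=> hQ surj ker; have [f0 f0E] := rho_surj_gen (lcomp phi (Hmap e)) hQ.
have [f fE] := nat_factor surj (ker f0 f0E).
exists f => t; have [t' ->] := hom_cover t surj.
apply: etrans (f0E t') _; apply: nattrans_ext => B x.
exact/esym/fE.
Qed.

(** An element of the kernel of the cover goes to an element of [Y] that all morphisms to
    [C0] annihilate. *)
Lemma rho_surj_mixed X Y Q K (e : nattrans Q X) (m : nattrans Y K) (phi : {linear H X -> H Y}) :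
  retract_of_power P Q -> nsurjective e -> retract_of_power I K -> ninjective m ->
  exists f : nattrans X Y, forall t : H X, phi t = ntcomp f t.
Proof.
move=> hQ surj hK inj; apply: (rho_surj_descend hQ surj) => f0 f0E B z ez.
apply: (cogenerated_eq0 hK inj) => g.
have := nt_app (f0E (yon (amap Q g z))) (rid C0).
rewrite !ntcomp_yon nappE ez amap_el0 yon_id nappE => <-.
have -> : (yon (0 : X C0) : H X) = 0 by apply: hom_ext; rewrite yon_id.
by rewrite raddf0.
Qed.

(** The composite of the lift with [d] vanishes on elements at [C0], and these generate
    [Q1]. *)
Lemma rho_surj_P1 X Y Q Q1 (d : nattrans Q1 Q) (e : nattrans Q X) (phi : {linear H X -> H Y}) :
  retract_of_power P Q -> retract_of_power P Q1 -> nsurjective e -> exact_at d e ->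
  exists f : nattrans X Y, forall t : H X, phi t = ntcomp f t.
Proof.
move=> hQ hQ1 surj ex; apply: (rho_surj_descend hQ surj) => f0 f0E B z /ex[w <-].
have : ntcomp f0 d = nt0 _ _.
  apply: (@generated_eq _ _ _ (ntid Q1)) => // [B' y|t]; first by exists y.
  rewrite -ntcompA -f0E.
  have -> : (ntcomp e (ntcomp d t) : H X) = 0.
    by apply: nattrans_ext => B' y; apply/ex; exists ((t : nattrans _ _) B' y).
  by rewrite raddf0; apply: nattrans_ext.
by move/nt_app/(_ B w).
Qed.

(** Into [Q] the map comes from a transformation, whose composite with [d] vanishes at
    [C0] and hence everywhere, as [Q1] is cogenerated there. *)
Lemma rho_surj_I1 X Y Q Q1 (m : nattrans Y Q) (d : nattrans Q Q1) (phi : {linear H X -> H Y}) :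
  retract_of_power I Q -> retract_of_power I Q1 -> ninjective m -> exact_at m d ->
  exists f : nattrans X Y, forall t : H X, phi t = ntcomp f t.
Proof.
move=> hQ hQ1 inj ex; have [f0 f0E] := rho_surj_cogen (lcomp (Hmap m) phi) hQ.
have df0 : ntcomp d f0 = nt0 _ _.
  apply: (@cogenerated_eq _ _ _ (ntid Q1)) => // [B x y //|t].
  rewrite -ntcompA -f0E; apply: nattrans_ext => B x.
  by apply/ex; exists ((phi t : nattrans _ _) B x).
have [B x|f fE] := nat_lift (g := f0) inj.
  by apply/ex; exact: (nt_app df0 x).
exists f => t; apply: nattrans_ext => B x; apply: inj; rewrite [RHS]fE.
exact: (nt_app (f0E t) x).
Qed.
End Rho.

(** * Density *)

Section Density.
Variables (R : comPzRingType) (E : lmodType R) (C : rcategory R) (C0 : C).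
Hypotheses (hR : artinian R) (hC : dualizing C E).
Hypothesis injE : injective_in (@everything (ModR R)) E.
Hypothesis cogE : forall (V : lmodType R) (x : V),
  (forall f : {linear V -> E}, f x = 0) -> x = 0.
Local Notation P := (repr_functor C0).
Local Notation A := (Rop P).
Local Notation I := (corepr E C0).
Local Notation H X := (homP_mod P X : lmodType A).
Implicit Types X Y Q : afunctor C.

Lemma Hmap_inj X Y (f : nattrans X Y) : (forall x : X C0, f C0 x = 0 -> x = 0) ->
  injective (@Hmap R C C0 X Y f).
Proof.
move=> h; apply: linear_inj0 => t ft; apply: hom_ext; apply: h.
exact: (nt_app ft (rid C0)).
Qed.

(** Finitely many of the maps of [HomP_corepr_separates] are jointly injective. *)
Lemma fg_embedding (M : lmodType A) : fg (M : ModR A) ->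
  exists (Z : C) (u : {linear M -> H (corepr E Z)}),
    retract_of_power I (corepr E Z) /\ injective u.
Proof.
move=> hM; have dM := fg_dcc_endo hR (hom_fg hC C0 C0) hM.
have [||n [f sep]] := dcc_separation (T := {linear M -> H I}) (k := fun f x => f x = 0) dM.
- exact: ker_submodule.
- by move=> x; exact: (HomP_corepr_separates cogE).
have [[hZ hB _ _] _] := hC.
have [Z [i [p [pi ip]]]] := direct_power_ex C0 n hZ hB.
have lin : linear (fun m : M => \sum_j Hmap C0 (corepr_map E (p j)) (f j m)).
  move=> c x y; rewrite scaler_sumr -big_split /=; apply: eq_bigr => j _.
  by rewrite linearP [LHS]linearP.
exists Z, (mklin lin); split; first exact: corepr_power ip.
apply: linear_inj0 => x ux; apply: sep => k; apply: nattrans_ext => B y.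
have e0 : \sum_j corepr_map E (p j) B ((f j x : nattrans P I) B y) = 0.
  by apply: etrans (nt_app ux y); exact/esym/nt_sumE.
have := congr1 (corepr_map E (i k) B) e0.
rewrite napp0 napp_sum (bigD1 k) // big1 => [|j jk]; last first.
  by rewrite (corepr_map_orthogonal pi) eq_sym (negbTE jk).
rewrite (corepr_map_orthogonal pi) eqxx => e1.
exact: etrans (esym (addr0 _)) e1.
Qed.

(** An idempotent of [H Q] comes from one of [Q], whose image is the summand. *)
Lemma retract_realization Q (M : lmodType A) (u : {linear M -> H Q}) (r : {linear H Q -> M}) :
  cancel u r ->
  (forall f g : nattrans Q Q, (forall t : H Q, ntcomp f t = ntcomp g t) -> f = g) ->
  (forall phi : {linear H Q -> H Q}, exists f : nattrans Q Q, forall t, phi t = ntcomp f t) ->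
  exists X, retract_of_power Q X /\ isomorphic (H X : ModR A) (M : ModR A).
Proof.
move=> ur faith full'; have [e eE] := full' (lcomp u r).
have ee : ntcomp e e = e.
  by apply: faith => t; rewrite -ntcompA -!eE /= ur.
have eeE B x : e B (e B x) = e B x := nt_app ee x.
pose k : nattrans Q Q := e - ntid Q.
pose T := mksub (ker_subclosed k).
have inT B x : x \in T B <-> e B x = x.
  rewrite (in_mksub (ker_subclosed k)); split=> [/eqP|ex]; last first.
    by apply/eqP; rewrite -[k B x]/(e B x - x) ex subrr.
  by rewrite -[k B x]/(e B x - x) subr_eq0 => /eqP.
have im B x : exists y, sub_incl T B y = e B x by apply/sub_incl_im/inT.
have [p pE] := nat_lift (@sub_incl_inj _ _ _ T) im.
have incE B y : e B (sub_incl T B y) = sub_incl T B y.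
  by apply/inT/sub_incl_im; exists y.
exists (sub_functor T); split.
  exists 1%N, (fun=> p), (fun=> sub_incl T) => B x; rewrite big_ord1.
  by apply: (@sub_incl_inj _ _ _ T); rewrite pE incE.
apply: (@isomorphic_same_image _ _ _ _ (@Hmap R C C0 _ _ (sub_incl T)) u).
- by apply: Hmap_inj => x h; apply: (@sub_incl_inj _ _ _ T); rewrite h napp0.
- exact: can_inj ur.
- move=> t; exists (r (Hmap C0 (sub_incl T) t)).
  apply: etrans (eE _) _; apply: nattrans_ext => B x; exact: incE.
- move=> m; exists (ntcomp p (u m) : H (sub_functor T)).
  apply: nattrans_ext => B x; apply: etrans (pE _ _) _.
  have := nt_app (eE (u m)) x.
  by rewrite /= ur => <-.
Qed.

(** An arrow between objects with property [G], a state of the constructions of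
    resolutions, which prolong an arrow on one side at each step. *)
Record arrow (G : ModC C -> Prop) := Arrow {
  asrc : ModC C; atgt : ModC C; amor : nattrans asrc atgt; asrcP : G asrc; atgtP : G atgt }.

Lemma bbP_intro X Q0 Q1 (d : nattrans Q1 Q0) (e : nattrans Q0 X) :
  fp (X : ModC C) -> projective_in (@fp R C) Q0 -> projective_in (@fp R C) Q1 ->
  in_add (P : ModC C) Q0 -> in_add (P : ModC C) Q1 -> nsurjective e -> exact_at d e ->
  bbP (P : ModC C) 1 X.
Proof.
move=> hX p0 p1 a0 a1 surj ex; split=> //.
pose G := projective_in (@fp R C).
have step (a : arrow G) : exists p : {Z : C & nattrans (repr_functor Z) (asrc a)},
    exact_at (projT2 p) (amor a).
  have [Z [k kE]] := kernel_cover hC (amor a) (asrcP a).1 (atgtP a).1.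
  by exists (existT _ Z k).
pose next a : arrow G := Arrow (projT2 (sval (cid (step a)))) (repr_projective _) (asrcP a).
pose s n := iter n next (Arrow d p1 p0 : arrow G).
exists (fun n => atgt (s n)), (fun n => amor (s n)), e; split=> //.
- by move=> n; apply: atgtP.
- by move=> n; exact: (svalP (cid (step (s n)))).
- by case=> [|[|n]].
Qed.

Lemma bbI_intro (J : afunctor C) X Q0 Q1 (e : nattrans X Q0) (d : nattrans Q0 Q1) :
  fp (X : ModC C) -> injective_in (@fp R C) Q0 -> injective_in (@fp R C) Q1 ->
  in_add (J : ModC C) Q0 -> in_add (J : ModC C) Q1 -> ninjective e -> exact_at e d ->
  bbI (J : ModC C) 1 X.
Proof.
move=> hX p0 p1 a0 a1 inj ex; split=> //.
pose G := injective_in (@fp R C).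
have step (a : arrow G) : exists p : {Z : C & nattrans (atgt a) (corepr E Z)},
    exact_at (amor a) (projT2 p).
  have [Z [k kE]] := cokernel_hull hC (amor a) (asrcP a).1 (atgtP a).1.
  by exists (existT _ Z k).
pose next a : arrow G :=
  Arrow (projT2 (sval (cid (step a)))) (atgtP a) (corepr_injective hC _ injE).
pose s n := iter n next (Arrow d p0 p1 : arrow G).
exists (fun n => asrc (s n)), (fun n => amor (s n)), e; split=> //.
- by move=> n; apply: asrcP.
- by move=> n; exact: (svalP (cid (step (s n)))).
- by case=> [|[|n]].
Qed.

(** The functor represented by the sum of [n] copies of [C0] has the free module of rank
    [n] as its value, the coordinates being given by the injections [i]. *)
Lemma free_cover (M : lmodType A) : fg (M : ModR A) ->
  exists (Z : C) (q : {linear H (repr_functor Z) -> M}),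
    retract_of_power P (repr_functor Z) /\ forall m, exists t, q t = m.
Proof.
move=> [n [v gen]]; have [[hZ hB _ _] _] := hC.
have [Z [i [p [pi ip]]]] := direct_power_ex C0 n hZ hB.
pose b (t : H (repr_functor Z)) : rhom Z C0 := (t : nattrans P (repr_functor Z)) C0 (rid C0).
have lin : linear (fun t : H (repr_functor Z) => \sum_j act (b t ⊚ i j) *: v j).
  move=> c s t; rewrite scaler_sumr -big_split /=; apply: eq_bigr => j _.
  rewrite scalerA -scalerDl [c]actE actM -actD; congr (act _ *: _).
  rewrite rcompA -rcompDl; congr (_ ⊚ _).
  by rewrite -[LHS]/(b (act _ *: s) + b t) /b act_app.
exists Z, (mklin lin); split; first exact: repr_power ip.
move=> m; have [c ->] := gen m.
pose y : rhom Z C0 := \sum_j (c j : nattrans P P) C0 (rid C0) ⊚ p j.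
exists (yon (y : repr_functor Z C0)); apply: eq_bigr => j _.
rewrite /b yon_id [c j in RHS]actE; congr (act _ *: _).
rewrite rcomp_suml (bigD1 j) // big1 => [|k kj]; last first.
  by rewrite -rcompA pi (negbTE kj) rcomp0r.
by apply: etrans (addr0 _) _; rewrite -rcompA pi eqxx rcompr1.
Qed.

(** [M] is the image of a map from a free module into a power of the value of
    [corepr C0]; both come from functors, and since the kernel of the resulting
    transformation is finitely presented, [M] has a finite presentation. *)
Lemma P1_dense (M : lmodType A) : fg (M : ModR A) ->
  exists2 X, bbP (P : ModC C) 1 X & isomorphic (H X : ModR A) (M : ModR A).
Proof.
move=> hM; have [ZI [u [_ uinj]]] := fg_embedding hM.
have [Z0 [q [ret0 qsurj]]] := free_cover hM.
pose Q0 := repr_functor Z0; pose K := corepr E ZI.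
have [g gE] := rho_surj_gen (lcomp u q : {linear H Q0 -> H K}) ret0.
have [ZK [k ex]] := kernel_cover hC g (fp_repr Z0) (corepr_fp hC ZI).
(* A free cover of the value of the cover [ZK] turns the kernel of [g] at [C0] into the
   image of [d]. *)
have fgK : fg (H (repr_functor ZK) : ModR A).
  exact/HomP_fg/(fp_value_fg hC)/fp_repr.
have [Z1 [q1 [ret1 q1surj]]] := free_cover fgK.
pose Q1 := repr_functor Z1.
have [d dE] := rho_surj_gen (lcomp (Hmap C0 k) q1 : {linear H Q1 -> H Q0}) ret1.
pose T := mksub (im_subclosed d); pose X : afunctor C := quo_functor T.
pose e : nattrans Q0 X := quo_proj T.
have exd : exact_at d e by move=> B y; rewrite quo_proj_eq0 (in_mksub (im_subclosed d)).
have gd : ntcomp g d = nt0 _ _.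
  apply: (@generated_eq _ _ _ _ _ _ (ntid Q1)) ret1 _ _ => [B y|t]; first by exists y.
  rewrite -ntcompA -dE; apply: nattrans_ext => B y.
  by apply/ex; exists ((q1 t : nattrans _ _) B y).
have [gb gbE] : exists gb : nattrans X K, forall B y, gb B (e B y) = g B y.
  apply: nat_factor; first exact: quo_proj_surj.
  by move=> B y /exd[z <-]; exact: (nt_app gd z).
have esurj : nsurjective e by exact: quo_proj_surj.
exists X.
  apply: (@bbP_intro X Q0 Q1 d e) => //; try exact: repr_projective; try exact/in_addP.
  by exists Z1, Z0, d, e.
apply: (@isomorphic_same_image _ _ _ _ (@Hmap R C C0 _ _ gb) u) => //.
- apply: Hmap_inj => x; have [y <-] := esurj C0 x; rewrite gbE => /ex[z kz].
  have [t tE] := q1surj (yon z); apply/exd; exists ((t : nattrans _ _) C0 (rid C0)).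
  have dt : k C0 ((q1 t : nattrans P (repr_functor ZK)) C0 (rid C0)) =
    d C0 ((t : nattrans P Q1) C0 (rid C0)) := nt_app (dE t) (rid C0).
  by rewrite -dt tE yon_id.
- move=> t; have [t' ->] := hom_cover t esurj; exists (q t').
  apply: etrans (gE t') _; apply: nattrans_ext => B y; exact/esym/gbE.
- move=> m; have [t <-] := qsurj m; exists (ntcomp e t : H X).
  apply: etrans _ (esym (gE t)); apply: nattrans_ext => B y; exact: gbE.
Qed.

(** [M] and the cokernel of an embedding of [M] both embed in values of powers of [I],
    so [M] is the kernel of a map between such values, which comes from [d]. *)
Lemma I1_dense (J : afunctor C) (M : lmodType A) : retract_of_power J I -> fg (M : ModR A) ->
  exists2 X, bbI (J : ModC C) 1 X & isomorphic (H X : ModR A) (M : ModR A).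
Proof.
move=> JI hM; have [Z0 [u [ret0 uinj]]] := fg_embedding hM.
pose K0 := corepr E Z0; pose N := submod_of (im_submodule u).
have fgN : fg (modquot N : ModR A).
  apply: (fg_quotient (@modproj_surj _ _ N)).
  exact/HomP_fg/(fp_value_fg hC)/(corepr_fp hC).
have [Z1 [u1 [ret1 u1inj]]] := fg_embedding fgN.
pose K1 := corepr E Z1.
have [d dE] := rho_surj_cogen (lcomp u1 (modproj N) : {linear H K0 -> H K1}) ret1.
pose T := mksub (ker_subclosed d); pose X : afunctor C := sub_functor T.
pose e : nattrans X K0 := sub_incl T.
have ex : exact_at e d by move=> B y; rewrite -(in_mksub (ker_subclosed d)) sub_incl_im.
have fpK Z : fp (corepr E Z : ModC C) := corepr_fp hC Z.
have einj : ninjective e by exact: sub_incl_inj.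
exists X.
  apply: (@bbI_intro J X K0 K1 e d) => //; try exact: corepr_injective;
    try by apply/in_addP; apply: retract_of_power_trans JI _.
  exact: (ker_fp hC d (fpK Z0) (fpK Z1)).
have kerE (t : H K0) : ntcomp d t = (0 : H K1) <-> exists m, u m = t.
  rewrite -dE -(in_submod_of (im_submodule u)) -[t \in _]/(t \in N) -modproj_eq0.
  split=> [h|h]; last by rewrite /= h raddf0.
  by apply: u1inj; rewrite raddf0.
apply: (@isomorphic_same_image _ _ _ _ (@Hmap R C C0 _ _ e) u) => //.
- by apply: Hmap_inj => x h; apply: einj; rewrite h napp0.
- move=> t; have [|m mE] := (kerE (ntcomp e t : H K0)).1; last by exists m.
  by apply: nattrans_ext => B y; apply/ex; exists ((t : nattrans _ _) B y).
- move=> m; have /nt_app h : ntcomp d (u m) = (0 : H K1) by apply/kerE; exists m.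
  have [B y|t tE] := nat_lift (g := u m) einj; first by apply/ex; exact: h.
  by exists t; apply: nattrans_ext => B y; exact: tE.
Qed.

(** A dual basis of [X] over [P] is one of [HomP P X] over [A]. *)
Lemma add_P_value X : retract_of_power P X ->
  fg (H X : ModR A) /\ projective_in (@everything (ModR A)) (H X : ModR A).
Proof.
move=> [n [s [r sr]]].
have tE (t : H X) : t = \sum_i (ntcomp (r i) t : A) *: (s i : H X).
  by apply: nattrans_ext => B x; rewrite nt_sumE -[LHS]sr.
split; first by exists n, s => t; exists (fun i => ntcomp (r i) t : A).
split=> // U V _ _ e f /epi_surjective surj.
have [a aE] := choice (fun i => surj (f (s i))).
have lin : linear (fun t : H X => \sum_i (ntcomp (r i) t : A) *: a i).
  move=> c t t'; rewrite scaler_sumr -big_split /=; apply: eq_bigr => i _.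
  rewrite scalerA -scalerDl; congr (_ *: _).
  by apply: nattrans_ext => B x; rewrite /= nappD.
exists (mklin lin); apply: linear_ext => t; rewrite [in RHS](tE t) /= /linmap !linear_sum.
by apply: eq_bigr => i _; rewrite !linearZ_LR aE.
Qed.

Lemma add_I_value X : retract_of_power I X ->
  fg (H X : ModR A) /\ injective_in (@everything (ModR A)) (H X : ModR A).
Proof.
move=> [n [s [r sr]]].
have tE (t : H X) : t = \sum_i Hmap C0 (s i) (Hmap C0 (r i) t).
  by apply: nattrans_ext => B x; rewrite nt_sumE -[LHS]sr.
split.
  have [k [w gen]] : fg (H I : ModR A) by exact/HomP_fg/(fp_value_fg hC)/(corepr_fp hC).
  apply: (@fg_of_finite _ _ ('I_n * 'I_k)%type (fun p => Hmap C0 (s p.1) (w p.2))) => t.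
  have [c cE] := choice (fun i => gen (Hmap C0 (r i) t)).
  exists (fun p => c p.1 p.2).
  rewrite -(pair_bigA _ (fun i j => c i j *: Hmap C0 (s i) (w j))) /=.
  rewrite {1}(tE t); apply: eq_bigr => i _; rewrite cE linear_sum.
  by apply: eq_bigr => j _; rewrite linearZ_LR.
split=> // U V _ _ m f /mono_injective inj.
have ext i : exists h : {linear V -> H I}, forall x, h (m x) = Hmap C0 (r i) (f x).
  apply: (@HomP_corepr_extend _ _ _ _ _ _ m (lcomp (Hmap C0 (r i)) f) injE) => x mx.
  by rewrite (inj x 0) ?raddf0.
have [h hE] := choice ext.
have lin : linear (fun y : V => \sum_i Hmap C0 (s i) (h i y)).
  move=> c x y; rewrite scaler_sumr -big_split /=; apply: eq_bigr => i _.
  by rewrite linearP [LHS]linearP.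
exists (mklin lin); apply: linear_ext => x; rewrite [RHS](tE (f x)).
by apply: eq_bigr => i _; rewrite hE.
Qed.

Lemma add_P_dense (M : lmodType A) : fg (M : ModR A) ->
  projective_in (@everything (ModR A)) (M : ModR A) ->
  exists2 X, retract_of_power P X & isomorphic (H X : ModR A) (M : ModR A).
Proof.
move=> hM [_ proj]; have [Z [q [ret surj]]] := free_cover hM.
have [|u /linear_app uE] := proj _ _ Logic.I Logic.I q (lid M); first exact/epi_surjective.
have [f g h|phi|X [rX iX]] := retract_realization (u := u) (r := q) uE.
- have surj1 : nsurjective (ntid (repr_functor Z)) by move=> B y; exists y.
  exact: (generated_eq ret surj1 h).
- exact: rho_surj_gen.
by exists X => //; apply: retract_of_power_trans rX.
Qed.

Lemma add_I_dense (M : lmodType A) : fg (M : ModR A) ->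
  injective_in (@everything (ModR A)) (M : ModR A) ->
  exists2 X, retract_of_power I X & isomorphic (H X : ModR A) (M : ModR A).
Proof.
move=> hM [_ inj]; have [Z [u [ret uinj]]] := fg_embedding hM.
have [|r /linear_app rE] := inj _ _ Logic.I Logic.I u (lid M); first exact/mono_injective.
have [f g h|phi|X [rX iX]] := retract_realization (u := u) (r := r) rE.
- have inj1 : ninjective (ntid (corepr E Z)) by move=> B x y.
  exact: (cogenerated_eq ret inj1 h).
- exact: (rho_surj_cogen phi ret).
by exists X => //; apply: (retract_of_power_trans ret rX).
Qed.
End Density.

(** * The equivalences induced by Hom(P, -) *)

Theorem proposition7p8
  (R : comPzRingType) (hR : artinian R)
  (E : lmodType R)
  (eps : @mor (ModR R) (modquot (radm (R^o : lmodType R))) E)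
  (hE : injective_envelope_in (@everything (ModR R)) eps)
  (C : rcategory R) (hC : dualizing C E)
  (C0 : C) (P : ModC C) (hP : P = repr_functor C0)
  (J : ModC C) (iota : @mor (ModC C) (quo_functor (radf P)) J)
  (hJ : injective_envelope_in (@fp R C) iota) :
  (forall X : ModC C, fp X -> fg (HomP P X)) /\
  (induces_equivalence (HomP P) (bbP P 1) fg /\
   induces_equivalence (HomP P) (bbI J 1) fg) /\
  (forall X Y : ModC C, fp X -> fp Y ->
    [/\ bbP P 0 X \/ bbI J 0 Y -> injective (@rho R C P X Y),
        bbP P 0 X -> bbI J 0 Y -> bijective (@rho R C P X Y)
      & bbP P 1 X \/ bbI J 1 Y -> bijective (@rho R C P X Y)]) /\
  (induces_equivalence (HomP P) (in_add P)
     (fun M => fg M /\ projective_in (@everything (ModR (Rop P))) M) /\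
   induces_equivalence (HomP P) (in_add J)
     (fun M => fg M /\ injective_in (@everything (ModR (Rop P))) M)).
Proof.
move: iota hJ; rewrite {}hP => {P} iota hJ; pose P := repr_functor C0.
have [_ injE _] := hE; have cogE := cogenerator hR hE.
pose I := corepr E C0.
have JI : retract_of_power J I := corepr_retract_envelope hR hC injE hJ.
have IJ : retract_of_power I J := envelope_retract_corepr hR hC injE cogE hJ.
have addP Q : in_add (P : ModC C) Q -> retract_of_power P Q by move/in_addP.
have addJ Q : in_add J Q -> retract_of_power I Q.
  by move/in_addP; apply: retract_of_power_trans.
have rho_bij X Y : injective (@rho R C P X Y) ->
    (forall phi : {linear homP_mod P X -> homP_mod P Y},
       exists f : nattrans X Y, forall t : homP_mod P X, phi t = ntcomp f t) ->
    bijective (@rho R C P X Y).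
  move=> inj surj; apply: inj_surj_bijective => // phi.
  have [f fE] := surj phi; exists f; apply: linear_ext => t; exact/esym/fE.
have rho_inj_P X Y Q (e : nattrans Q X) : retract_of_power P Q -> nsurjective e ->
    injective (@rho R C P X Y).
  move=> hQ es f g /linear_app fg; exact: (generated_eq hQ es fg).
have rho_inj_I X Y Q (m : nattrans Y Q) : retract_of_power I Q -> ninjective m ->
    injective (@rho R C P X Y).
  move=> hQ mi f g /linear_app fg; exact: (cogenerated_eq hQ mi fg).
have bijP1 X Y : bbP (P : ModC C) 1 X -> bijective (@rho R C P X Y).
  move=> [_ [Q [d [e [_ es ex _ hQ]]]]]; have := addP _ (hQ 0%N isT) => h0.
  apply: rho_bij => [|phi]; first exact: rho_inj_P h0 es.
  exact: (rho_surj_P1 phi h0 (addP _ (hQ 1%N isT)) es ex).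
have bijI1 X Y : bbI J 1 Y -> bijective (@rho R C P X Y).
  move=> [_ [Q [d [e [_ ei ex _ hQ]]]]]; have := addJ _ (hQ 0%N isT) => h0.
  apply: rho_bij => [|phi]; first exact: rho_inj_I h0 ei.
  exact: (rho_surj_I1 phi h0 (addJ _ (hQ 1%N isT)) ei ex).
have fgH X : fp (X : ModC C) -> fg (HomP P X).
  by move=> hX; apply/HomP_fg/(fp_value_fg hC).
split=> //; split; first split.
- apply: induces_equivalence_intro => [X [hX _]|X Y hX _|M]; first exact: fgH.
    exact: bijP1.
  exact: (P1_dense hR hC cogE).
- apply: induces_equivalence_intro => [X [hX _]|X Y _ hY|M]; first exact: fgH.
    exact: bijI1.
  exact: (I1_dense hR hC injE cogE JI).
split=> [X Y hX hY|].
  split.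
  - case=> [[_ [Q [d [e [_ es _ _ hQ]]]]]|[_ [Q [d [e [_ ei _ _ hQ]]]]]].
      exact: rho_inj_P (addP _ (hQ 0%N isT)) es.
    exact: rho_inj_I (addJ _ (hQ 0%N isT)) ei.
  - move=> [_ [Q [d [e [_ es _ _ hQ]]]]] [_ [K [d' [m [_ mi _ _ hK]]]]].
    apply: rho_bij => [|phi]; first exact: rho_inj_P (addP _ (hQ 0%N isT)) es.
    exact: (rho_surj_mixed phi (addP _ (hQ 0%N isT)) es (addJ _ (hK 0%N isT)) mi).
  - by case; [exact: bijP1 | exact: bijI1].
split.
- apply: induces_equivalence_intro => [X /addP|X Y /addP hX _|M [hM pM]].
  + exact: add_P_value.
  + have ids : nsurjective (ntid X) by move=> B x; exists x.
    apply: rho_bij => [|phi]; first exact: rho_inj_P hX ids.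
    exact: rho_surj_gen.
  + have [X hX iX] := add_P_dense hC hM pM.
    by exists X => //; apply/in_addP.
- apply: induces_equivalence_intro => [X /addJ|X Y _ /addJ hY|M [hM iM]].
  + exact: (add_I_value hC injE).
  + have idi : ninjective (ntid Y) by move=> B x y.
    apply: rho_bij => [|phi]; first exact: rho_inj_I hY idi.
    exact: (rho_surj_cogen phi hY).
  + have [X hX iX] := add_I_dense hR hC cogE hM iM.
    by exists X => //; apply/in_addP; apply: retract_of_power_trans hX.
Qed.
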